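(* Let $(X,\mathscr A,\mu)$ be a $\sigma$-finite measure space, let $\phi\colon X\to X$ and $w\colon X\to\mathbb C$ be $\mathscr A$-measurable, and assume that the weighted composition operator $C_{\phi,w}$ is densely defined in $L^2(\mu)$. Then the reciprocal $(C_{\phi,w}^* )^\dag$ of the adjoint $C_{\phi,w}^*$ satisfies: (i) $\mathcal D((C_{\phi,w}^* )^\dag)=\{f\in L^2(\mu)\colon \frac{w}{\mathsf h_{\phi,w}\circ\phi}\,(f\circ\phi)\in L^2(\mu)\}$, (ii) $(C_{\phi,w}^* )^\dag f=\frac{w}{\mathsf h_{\phi,w}\circ\phi}\,(f\circ\phi)$ for $f\in\mathcal D((C_{\phi,w}^* )^\dag)$, (iii) $(C_{\phi,w}^* )^\dag=M_{\mathsf h_{\phi,w}^{-1/2}\circ\phi}\,U$, where $U$ is the unitary part (i.e. the partial isometry factor) of the polar decomposition $C_{\phi,w}=U|C_{\phi,w}|$.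
   Context: Notation: $\mathcal D(T)$, $\mathcal N(T)$, $\mathcal R(T)$ are the domain, kernel and range of an operator $T$; $L^2(\mu)$ is the complex Hilbert space of square $\mu$-integrable $\mathscr A$-measurable complex functions on $X$. Conventions: $\frac10=\infty$, $0\cdot\infty=0$. Weighted composition operators. Put $\mu_w(\sigma)=\int_\sigma|w|^2\,d\mu$ and $\mu_w\circ\phi^{-1}(\sigma)=\mu_w(\phi^{-1}(\sigma))$ for $\sigma\in\mathscr A$. If $\mu_w\circ\phi^{-1}$ is absolutely continuous with respect to $\mu$, then $C_{\phi,w}$ is said to be well-defined and is the operator in $L^2(\mu)$ with $\mathcal D(C_{\phi,w})=\{f\in L^2(\mu)\colon w\cdot(f\circ\phi)\in L^2(\mu)\}$, $C_{\phi,w}f=w\cdot(f\circ\phi)$ (it is closed). ''Densely defined'' includes being well-defined. $\mathsf h_{\phi,w}\colon X\to[0,\infty]$ is the Radon–Nikodym derivative: $\mu_w\circ\phi^{-1}(\Delta)=\int_\Delta\mathsf h_{\phi,w}\,d\mu$ for $\Delta\in\mathscr A$. For a measurable function $u$ on $X$, $M_u$ is the multiplication operator in $L^2(\mu)$: $\mathcal D(M_u)=\{f\in L^2(\mu)\colon uf\in L^2(\mu)\}$, $M_uf=uf$ (with the convention $\infty\cdot 0=0$ where $u=\infty$). Products of operators have their natural (maximal) domains. Reciprocal. Let $T$ be a linear operator in a Hilbert space $\mathcal H$ with $\mathcal D(T)=\mathcal N(T)\oplus(\mathcal D(T)\cap\mathcal N(T)^\perp)$ (this holds for closed $T$). The reciprocal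 $T^\dag$ is the unique densely defined operator with domain $\mathcal D(T^\dag)=\mathcal R(T)\oplus\mathcal R(T)^\perp$ such that $TT^\dag f=P_{\overline{\mathcal R(T)}}f$ for $f\in\mathcal D(T^\dag)$, $T^\dag Tg=P_{\mathcal N(T)^\perp}g$ for $g\in\mathcal D(T)$, and $\mathcal N(T^\dag)=\mathcal R(T)^\perp$, where $P_M$ is the orthogonal projection onto the closed subspace $M$. *)

(* Defs.v *)
From HB Require Import structures.
From mathcomp Require Import all_boot all_order all_algebra.
From mathcomp Require Import generic_quotient ring_quotient sesquilinear.
From mathcomp Require Import complex ring lra.
From mathcomp Require Import all_classical all_reals all_analysis.
From mathcomp Require Import measurable_realfun.
Set Implicit Arguments.
Unset Strict Implicit.
Unset Printing Implicit Defensive.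
Import Order.TTheory GRing.Theory Num.Theory Num.Def.
Local Open Scope classical_set_scope.
Local Open Scope ring_scope.

Section SquareIntegrable.
Context {R : realType} {d : measure_display} {X : measurableType d}.
Implicit Types (z : R[i]) (f g : X -> R[i]).

(* |z|^2 as an element of R; `|z| itself lives in R[i] *)
Definition csqr z : R := complex.Re z ^+ 2 + complex.Im z ^+ 2.

Lemma csqrE z : ((csqr z)%:C)%C = z * conjC z.
Proof.
case: z => a b; rewrite /csqr /= /conjC/=; apply/eqP; rewrite eq_complex /=.
by apply/andP; split; apply/eqP; ring.
Qed.

Lemma csqr_ge0 z : 0 <= csqr z.
Proof. by rewrite addr_ge0 ?sqr_ge0. Qed.

Lemma csqr_eq0 z : csqr z = 0 -> z = 0.
Proof.
case: z => a b; rewrite /csqr/= => /eqP.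
by rewrite paddr_eq0 ?sqr_ge0 // !sqrf_eq0 => /andP[/eqP-> /eqP->].
Qed.

(* measurability for the Borel sigma-algebra of R[i], through R[i] = R * R *)
Definition cmeasurable f :=
  measurable_fun [set: X] (fun x => complex.Re (f x)) /\
  measurable_fun [set: X] (fun x => complex.Im (f x)).

Lemma cmeasurable0 : cmeasurable (0 : X -> R[i]).
Proof. by split; exact: measurable_cst. Qed.

Lemma cmeasurableB f g : cmeasurable f -> cmeasurable g -> cmeasurable (f - g).
Proof.
move=> [mf1 mf2] [mg1 mg2]; split.
  rewrite (_ : (fun _ => _) = (fun x => complex.Re (f x) - complex.Re (g x))).
    exact: measurable_funB.
  by apply/funext => x; rewrite !fctE; case: (f x) (g x) => ? ? [].
rewrite (_ : (fun _ => _) = (fun x => complex.Im (f x) - complex.Im (g x))).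
  exact: measurable_funB.
by apply/funext => x; rewrite !fctE; case: (f x) (g x) => ? ? [].
Qed.

Lemma cmeasurableM f g :
  cmeasurable f -> cmeasurable g -> cmeasurable (fun x => f x * g x).
Proof.
move=> [mf1 mf2] [mg1 mg2]; split.
  rewrite (_ : (fun _ => _) = (fun x => complex.Re (f x) * complex.Re (g x)
     - complex.Im (f x) * complex.Im (g x))).
    by apply: measurable_funB; exact: measurable_funM.
  by apply/funext => x; case: (f x) (g x) => ? ? [].
rewrite (_ : (fun _ => _) = (fun x => complex.Re (f x) * complex.Im (g x)
     + complex.Im (f x) * complex.Re (g x))).
  by apply: measurable_funD; exact: measurable_funM.
by apply/funext => x; case: (f x) (g x) => ? ? [? ?] /=.
Qed.

Lemma cmeasurableC f : cmeasurable f -> cmeasurable (fun x => conjC (f x)).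
Proof.
move=> [mf1 mf2]; split.
  rewrite (_ : (fun _ => _) = (fun x => complex.Re (f x))) //.
  by apply/funext => x; case: (f x).
rewrite (_ : (fun _ => _) = (fun x => - complex.Im (f x))).
  exact: measurableT_comp.
by apply/funext => x; case: (f x).
Qed.

Lemma measurable_csqr f : cmeasurable f ->
  measurable_fun [set: X] (fun x => csqr (f x)).
Proof. by move=> [? ?]; apply: measurable_funD; exact: measurable_funX. Qed.

Variable mu : {measure set X -> \bar R}.

Definition square_integrable f :=
  cmeasurable f /\ (\int[mu]_x (csqr (f x))%:E < +oo)%E.

Lemma integrable_csqr f : square_integrable f ->
  mu.-integrable [set: X] (fun x => (csqr (f x))%:E).
Proof.
move=> [mf If]; apply/integrableP; split.
  by apply/measurable_EFinP; exact: measurable_csqr.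
by under eq_integral do rewrite gee0_abs ?lee_fin ?csqr_ge0 //.
Qed.

Lemma square_integrable_le f g h (a b : R) : cmeasurable h ->
  square_integrable f -> square_integrable g ->
  (forall x, csqr (h x) <= a * csqr (f x) + b * csqr (g x)) ->
  square_integrable h.
Proof.
move=> mh Lf Lg hfg; split => //.
have If : mu.-integrable [set: X] (fun x => (a * csqr (f x) + b * csqr (g x))%:E).
  under [X in mu.-integrable _ X]eq_fun do rewrite EFinD !EFinM.
  by apply: integrableD => //; apply: integrableZl => //; exact: integrable_csqr.
have /integrableP[_] : mu.-integrable [set: X] (fun x => (csqr (h x))%:E).
  apply: le_integrable If => //.
    by apply/measurable_EFinP; exact: measurable_csqr.
  move=> x _; rewrite !gee0_abs ?lee_fin ?csqr_ge0 //.
  by rewrite (le_trans _ (hfg x)) ?csqr_ge0.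
by under eq_integral do rewrite gee0_abs ?lee_fin ?csqr_ge0 //.
Qed.

Lemma square_integrable0 : square_integrable 0.
Proof.
split; first exact: cmeasurable0.
under eq_integral do rewrite /csqr /= !expr0n /= addr0.
by rewrite integral0.
Qed.

Lemma square_integrableB f g :
  square_integrable f -> square_integrable g -> square_integrable (f - g).
Proof.
move=> Lf Lg; apply: (square_integrable_le (a := 2) (b := 2) _ Lf Lg).
  by apply: cmeasurableB; [case: Lf | case: Lg].
move=> x; rewrite !fctE /csqr; case: (f x) (g x) => a b [u v] /=.
have := sqr_ge0 (a + u); have := sqr_ge0 (b + v); nra.
Qed.

Lemma csqrM (y z : R[i]) : csqr (y * z) = csqr y * csqr z.
Proof. by case: y z => a b [u v]; rewrite /csqr/=; ring. Qed.

Lemma square_integrableZ (a : R[i]) f :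
  square_integrable f -> square_integrable (fun x => a * f x).
Proof.
move=> Lf; apply: (square_integrable_le (a := csqr a) (b := 0) _ Lf Lf).
  by apply: cmeasurableM; [split; exact: measurable_cst | case: Lf].
by move=> x; rewrite csqrM mul0r addr0.
Qed.

Definition cintegral f : R[i] :=
  (Rintegral mu [set: X] (fun x => complex.Re (f x)) +i*
   Rintegral mu [set: X] (fun x => complex.Im (f x)))%C.

Definition cintegrable f :=
  mu.-integrable [set: X] (fun x => (complex.Re (f x))%:E) /\
  mu.-integrable [set: X] (fun x => (complex.Im (f x))%:E).

Lemma cintegrableM f g : square_integrable f -> square_integrable g ->
  cintegrable (fun x => f x * conjC (g x)).
Proof.
move=> Lf Lg.
have [m1 m2] : cmeasurable (fun x => f x * conjC (g x)).
  by apply: cmeasurableM; [case: Lf | apply: cmeasurableC; case: Lg].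
have I : mu.-integrable [set: X] (fun x => (csqr (f x) + csqr (g x))%:E).
  under [X in mu.-integrable _ X]eq_fun do rewrite EFinD.
  by apply: integrableD => //; exact: integrable_csqr.
split; apply: le_integrable I => //; do ?exact/measurable_EFinP.
  move=> x _; rewrite !abse_EFin lee_fin.
  rewrite [leRHS]ger0_norm; last by rewrite addr_ge0 ?csqr_ge0.
  rewrite /csqr.
  case: (f x) (g x) => a b [u v] /=; rewrite ler_norml.
  have := sqr_ge0 (a + u); have := sqr_ge0 (b + v).
  have := sqr_ge0 (a - u); have := sqr_ge0 (b - v).
  have := sqr_ge0 a; have := sqr_ge0 b; have := sqr_ge0 u; have := sqr_ge0 v.
  by move=> *; apply/andP; split; nra.
move=> x _; rewrite !abse_EFin lee_fin.
rewrite [leRHS]ger0_norm; last by rewrite addr_ge0 ?csqr_ge0.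
  rewrite /csqr.
case: (f x) (g x) => a b [u v] /=; rewrite ler_norml.
have := sqr_ge0 (a + v); have := sqr_ge0 (b + u).
have := sqr_ge0 (a - v); have := sqr_ge0 (b - u).
have := sqr_ge0 a; have := sqr_ge0 b; have := sqr_ge0 u; have := sqr_ge0 v.
by move=> *; apply/andP; split; nra.
Qed.

Lemma eq_ae_cintegral f g : cmeasurable f -> cmeasurable g ->
  f = g %[ae mu] -> cintegral f = cintegral g.
Proof.
move=> [mf1 mf2] [mg1 mg2] fg; rewrite /cintegral /Rintegral.
congr ((fine _ +i* fine _)%C); apply: ae_eq_integral => //;
  do ?exact/measurable_EFinP; by apply: filterS fg => x /= /(_ I) ->.
Qed.

Lemma cintegralD f g : cintegrable f -> cintegrable g ->
  cintegral (fun x => f x + g x) = cintegral f + cintegral g.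
Proof.
move=> [If1 If2] [Ig1 Ig2]; rewrite /cintegral.
rewrite -[RHS]/((_ + _) +i* (_ + _))%C -!RintegralD //.
by congr (_ +i* _)%C; apply: eq_Rintegral => x _; case: (f x) (g x) => ? ? [].
Qed.

Lemma cintegralZ (a : R[i]) f : cintegrable f ->
  cintegral (fun x => a * f x) = a * cintegral f.
Proof.
move=> [If1 If2]; rewrite /cintegral; case: a => a b.
rewrite -[RHS]/((_ - _) +i* (_ + _))%C -!RintegralZl //.
have IZ (c : R) (h : X -> R) : mu.-integrable setT (EFin \o h) ->
    mu.-integrable setT (EFin \o (fun x => c * h x)).
  move=> Ih; under [X in mu.-integrable _ X]eq_fun do rewrite /= EFinM.
  exact: integrableZl.
rewrite -RintegralB ?IZ // -RintegralD ?IZ //.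
by congr (_ +i* _)%C; apply: eq_Rintegral => x _; case: (f x).
Qed.

Lemma cintegralC f : cintegrable f ->
  cintegral (fun x => conjC (f x)) = conjC (cintegral f).
Proof.
move=> [If1 If2]; rewrite /cintegral.
rewrite -[RHS]/(_ +i* (- _))%C.
congr (_ +i* _)%C; first by apply: eq_Rintegral => x _; case: (f x).
rewrite -mulN1r -RintegralZl //; apply: eq_Rintegral => x _.
by rewrite mulN1r; case: (f x).
Qed.

End SquareIntegrable.

Section L2.
Context {R : realType} {d : measure_display} {X : measurableType d}.
Variable mu : {measure set X -> \bar R}.

Definition L2fun : {pred X -> R[i]} := fun f => `[< square_integrable mu f >].

Lemma L2fun_zmod_closed : zmod_closed L2fun.
Proof.
split; first by apply/asboolP; exact: square_integrable0.
by move=> f g /asboolP Lf /asboolP Lg; apply/asboolP; exact: square_integrableB.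
Qed.
HB.instance Definition _ := GRing.isZmodClosed.Build _ L2fun L2fun_zmod_closed.

(* L2 is the quotient of preL2 by the functions that vanish almost everywhere *)
Record preL2 := PreL2 { preL2_val :> X -> R[i]; _ : preL2_val \in L2fun }.
HB.instance Definition _ := [isSub for preL2_val].
HB.instance Definition _ := [Choice of preL2 by <:].
HB.instance Definition _ := [SubChoice_isSubZmodule of preL2 by <:].

Lemma preL2P (f : preL2) : square_integrable mu f.
Proof. by case: f => f /= /asboolP. Qed.

Lemma preL2B (f g : preL2) x : (f - g) x = f x - g x.
Proof. by []. Qed.

Lemma preL2D (f g : preL2) x : (f + g) x = f x + g x.
Proof. by []. Qed.

Definition ae_null : {pred preL2} := fun f => `[< {ae mu, forall x, f x = 0} >].

Lemma ae_null_zmod_closed : zmod_closed ae_null.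
Proof.
split; first by apply/asboolP; apply/nearW.
move=> f g /asboolP f0 /asboolP g0; apply/asboolP.
move: f0 g0; apply: filterS2 => x f0 g0.
by rewrite preL2B f0 g0 subrr.
Qed.
HB.instance Definition _ :=
  GRing.isZmodClosed.Build _ ae_null ae_null_zmod_closed.

Definition L2 : Type := Quotient.quot ae_null.
HB.instance Definition _ := GRing.Zmodule.on L2.
HB.instance Definition _ := EqQuotient.on L2.

(* a chosen representative of the class u *)
Definition L2_fun (u : L2) : X -> R[i] := repr u.
Coercion L2_fun : L2 >-> Funclass.

Definition L2_mk f (Lf : square_integrable mu f) : L2 :=
  \pi_L2%qT (PreL2 (asboolT Lf)).

Lemma L2_square_integrable (u : L2) : square_integrable mu u.
Proof. exact: preL2P. Qed.

Lemma preL2_eqP (f g : preL2) :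
  (f : X -> R[i]) = g %[ae mu] <-> (\pi_L2 f = \pi_L2 g)%qT.
Proof.
split=> [fg|/eqP].
  apply/eqP; rewrite -Quotient.idealrBE; apply/asboolP.
  by apply: filterS fg => x /(_ I) fg; rewrite preL2B fg subrr.
rewrite -Quotient.idealrBE => /asboolP; apply: filterS => x + _.
by rewrite preL2B => /eqP; rewrite subr_eq0 => /eqP.
Qed.

Lemma L2_eqP (u v : L2) : (u : X -> R[i]) = v %[ae mu] <-> u = v.
Proof. by rewrite preL2_eqP !reprK. Qed.

Lemma L2_mkE f (Lf : square_integrable mu f) :
  (L2_mk Lf : X -> R[i]) = f %[ae mu].
Proof.
rewrite -[X in _ = X %[ae mu]]/(preL2_val (PreL2 (asboolT Lf))).
by apply/preL2_eqP; rewrite reprK.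
Qed.

Lemma L2_funD (u v : L2) :
  ((u + v : L2) : X -> R[i]) = (fun x => u x + v x) %[ae mu].
Proof.
rewrite -[X in _ = X %[ae mu]]/(preL2_val (repr u + repr v)).
apply/preL2_eqP; rewrite reprK -{1}[u]reprK -{1}[v]reprK.
exact/esym/Quotient.pi_add.
Qed.

Definition L2_scale (a : R[i]) (u : L2) : L2 :=
  L2_mk (square_integrableZ a (L2_square_integrable u)).

Lemma L2_scaleE a u : (L2_scale a u : X -> R[i]) = (fun x => a * u x) %[ae mu].
Proof. exact: L2_mkE. Qed.

Lemma L2_scaleA a b u : L2_scale a (L2_scale b u) = L2_scale (a * b) u.
Proof.
apply/L2_eqP; move: (L2_scaleE a (L2_scale b u)) (L2_scaleE b u)
  (L2_scaleE (a * b) u); apply: filterS3 => x /= + + + _.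
by move=> /(_ I)-> /(_ I)-> /(_ I)->; rewrite mulrA.
Qed.

Lemma L2_scale1 : left_id 1 L2_scale.
Proof.
move=> u; apply/L2_eqP; move: (L2_scaleE 1 u); apply: filterS => x /= + _.
by move=> /(_ I)->; rewrite mul1r.
Qed.

Lemma L2_scaleDr : right_distributive L2_scale +%R.
Proof.
move=> a u v; apply/L2_eqP.
apply: filterS3 (L2_scaleE a (u + v)) (L2_funD u v)
  (filterI (L2_funD (L2_scale a u) (L2_scale a v))
    (filterI (L2_scaleE a u) (L2_scaleE a v))) => x.
move=> /(_ I)E1 /(_ I)E2 [/(_ I)E3 [/(_ I)E4 /(_ I)E5]] _.
by rewrite E1 E2 E3 E4 E5 mulrDr.
Qed.

Lemma L2_scaleDl u : {morph L2_scale^~ u : a b / a + b}.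
Proof.
move=> a b; apply/L2_eqP.
apply: filterS3 (L2_scaleE (a + b) u)
  (L2_funD (L2_scale a u) (L2_scale b u))
  (filterI (L2_scaleE a u) (L2_scaleE b u)) => x.
move=> /(_ I)E1 /(_ I)E2 [/(_ I)E3 /(_ I)E4] _.
by rewrite E1 E2 E3 E4 mulrDl.
Qed.

HB.instance Definition _ := GRing.Zmodule_isLmodule.Build R[i] L2
  L2_scaleA L2_scale1 L2_scaleDr L2_scaleDl.

Definition L2_dot (u v : L2) : R[i] :=
  cintegral mu (fun x => u x * conjC (v x)).

Lemma L2_dotDl a (u v w : L2) :
  L2_dot (a *: u + v) w = a * L2_dot u w + L2_dot v w.
Proof.
have Iu := cintegrableM (L2_square_integrable u) (L2_square_integrable w).
have Iv := cintegrableM (L2_square_integrable v) (L2_square_integrable w).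
have Ia := cintegrableM (square_integrableZ a (L2_square_integrable u))
  (L2_square_integrable w).
rewrite /L2_dot -cintegralZ //.
have E : (fun x => a * (u x * conjC (w x))) = (fun x => a * u x * conjC (w x)).
  by apply/funext => x; rewrite mulrA.
rewrite E -cintegralD //; apply: eq_ae_cintegral.
- apply: cmeasurableM; first by case: (L2_square_integrable (a *: u + v)).
  by apply: cmeasurableC; case: (L2_square_integrable w).
- rewrite (_ : (fun x => _) = (fun x => (a * u x + v x) * conjC (w x))); last first.
    by apply/funext => x; rewrite mulrDl.
  apply: cmeasurableM; last by apply: cmeasurableC; case: (L2_square_integrable w).
  rewrite (_ : (fun x => _) = (fun x => a * u x) - (fun x => -1 * v x)).
    apply: cmeasurableB.
      by case: (square_integrableZ a (L2_square_integrable u)).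
    by case: (square_integrableZ (-1) (L2_square_integrable v)).
  by apply/funext => x; rewrite !fctE mulN1r opprK.
move: (L2_funD (a *: u) v) (L2_scaleE a u).
apply: filterS2 => x /= + + _ => /(_ I)-> /(_ I).
by rewrite -[a *: u]/(L2_scale a u) => ->; rewrite mulrDl.
Qed.

Lemma L2_dot_linearl (w : L2) : scalar (L2_dot^~ w).
Proof. by move=> a u v; exact: L2_dotDl. Qed.

Lemma L2_dotC (u v : L2) : L2_dot u v = (-1) ^+ false * conjC (L2_dot v u).
Proof.
have Iv := cintegrableM (L2_square_integrable v) (L2_square_integrable u).
rewrite expr0 mul1r -cintegralC //; congr cintegral.
by apply/funext => x; rewrite rmorphM /= conjCK mulrC.
Qed.

Lemma L2_dot_linearr (u : L2) : linear_for (conjC \; *%R) (L2_dot u).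
Proof.
move=> a v w; rewrite L2_dotC L2_dotDl rmorphD rmorphM /= expr0 mul1r.
by rewrite [in RHS]L2_dotC [L2_dot u w]L2_dotC !expr0 !mul1r.
Qed.

Lemma L2_dot_gt0 (u : L2) : u != 0 -> 0 < L2_dot u u.
Proof.
move=> u0; have Lu := L2_square_integrable u.
have -> : L2_dot u u = ((Rintegral mu setT (fun x => csqr (u x)))%:C)%C.
  rewrite /L2_dot /cintegral; congr (_ +i* _)%C.
    by apply: eq_Rintegral => x _; rewrite -csqrE.
  rewrite /Rintegral; under eq_integral do rewrite -csqrE /=.
  by rewrite integral0.
rewrite ltcR lt_neqAle Rintegral_ge0 ?andbT //; last first.
  by move=> x _; exact: csqr_ge0.
apply: contra u0 => /eqP/esym I0; apply/eqP/L2_eqP.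
have : (\int[mu]_x `|(csqr (u x))%:E| = 0)%E.
  under eq_integral do rewrite gee0_abs ?lee_fin ?csqr_ge0 //.
  rewrite -[LHS]fineK; first by rewrite -[fine _]/(Rintegral _ _ _) I0.
  by apply: integrable_fin_num => //; exact: integrable_csqr.
move=> /ae_eq_integral_abs => /(_ measurableT).
have mc : measurable_fun setT (fun x => (csqr (u x))%:E).
  by apply/measurable_EFinP; apply: measurable_csqr; case: Lu.
move=> /(_ mc) H0.
have Z : ((0 : L2) : X -> R[i]) = cst 0 %[ae mu].
  rewrite -[X in _ = X %[ae mu]]/(preL2_val 0).
  by apply/preL2_eqP; rewrite reprK piE.
by move: H0 Z; apply: filterS2 => x /= /(_ I) [] /csqr_eq0-> /(_ I)->.
Qed.

HB.instance Definition _ := @bilinear_isBilinear.Build R[i] L2 L2 R[i]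
  ( *%R) (conjC \; *%R) L2_dot (L2_dot_linearl, L2_dot_linearr).
HB.instance Definition _ :=
  @isHermitianSesquilinear.Build R[i] L2 false conjC L2_dot L2_dotC.
HB.instance Definition _ := isDotProduct.Build R[i] L2 L2_dot L2_dot_gt0.
End L2.

(* An unbounded operator in H is identified with its graph, a set of pairs
   (argument, value); equality of operators thus includes equality of domains. *)
Section Operators.
Context {C : numClosedFieldType} {H : lmodType C}.
Variable dot : {dot H for conjC}.
Implicit Types (S T U A : set (H * H)) (M N : set H) (f g k : H).

Definition hnorm f : C := sqrtC (dot f f).

Definition hclosure M : set H :=
  [set f | forall e : C, 0 < e -> exists2 g, M g & hnorm (f - g) < e].

Definition hdense M := hclosure M = [set: H].

Definition horth M : set H := [set f | forall g, M g -> dot f g = 0].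

Definition hsum M N : set H :=
  [set f | exists g k, [/\ M g, N k & f = g + k]].

(* the orthogonal projection onto M *)
Definition hproj M : set (H * H) :=
  [set p | M p.2 /\ horth M (p.1 - p.2)].

Definition linear_op T :=
  [/\ T (0, 0),
      forall (a : C) f g f' g', T (f, g) -> T (f', g') ->
        T (a *: f + f', a *: g + g')
    & forall f g g', T (f, g) -> T (f, g') -> g = g'].

Definition op_dom T : set H := [set f | exists g, T (f, g)].
Definition op_ran T : set H := [set g | exists f, T (f, g)].
Definition op_ker T : set H := [set f | T (f, 0)].

Definition op_comp S T : set (H * H) :=
  [set p | exists k, T (p.1, k) /\ S (k, p.2)].

Definition adjoint T : set (H * H) :=
  [set p | forall f g, T (f, g) -> dot g p.1 = dot f p.2].

Definition is_reciprocal T S :=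
  [/\ linear_op S /\ hdense (op_dom S),
      op_dom S = hsum (op_ran T) (horth (op_ran T)),
      forall f, op_dom S f ->
        exists2 g, hproj (hclosure (op_ran T)) (f, g) & op_comp T S (f, g),
      forall g, op_dom T g ->
        exists2 f, hproj (horth (op_ker T)) (g, f) & op_comp S T (g, f)
    & op_ker S = horth (op_ran T)].

(* reciprocal, abs_op and unitary_part are definite descriptions; when nothing
   satisfies the description, the value is the empty graph, which is not the
   graph of a linear operator. *)
Definition reciprocal T : set (H * H) := xget set0 (is_reciprocal T).

(* A is the positive selfadjoint square root of T^* T *)
Definition is_abs T A :=
  [/\ linear_op A,
      hdense (op_dom A) /\ adjoint A = A,
      forall f g, A (f, g) -> 0 <= dot g f
    & op_comp A A = op_comp (adjoint T) T].

Definition abs_op T : set (H * H) := xget set0 (is_abs T).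

Definition partial_isometry U :=
  [/\ linear_op U, op_dom U = [set: H],
      exists c : C, forall f g, U (f, g) -> hnorm g <= c * hnorm f
    & forall f g, horth (op_ker U) f -> U (f, g) -> hnorm g = hnorm f].

Definition is_unitary_part T U :=
  [/\ partial_isometry U, op_ker U = op_ker T & T = op_comp U (abs_op T)].

Definition unitary_part T : set (H * H) := xget set0 (is_unitary_part T).

End Operators.

Section WeightedComposition.
Context {R : realType} {d : measure_display} {X : measurableType d}.
Variable mu : {measure set X -> \bar R}.
Implicit Types (f : X -> R[i]) (u : X -> \bar R).

(* The product of u : X -> [0, +oo] and f : X -> R[i], with +oo * 0 = 0:
   it is an almost everywhere defined R[i]-valued function when f vanishes
   almost everywhere on [set x | u x = +oo]. Since fine +oo = 0, ecmul u f is
   then the product. *)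
Definition ecmul_defined u f :=
  {ae mu, forall x, u x \is a fin_num \/ f x = 0}.
Definition ecmul u f : X -> R[i] := fun x => ((fine (u x))%:C)%C * f x.

Definition ecmul_in_L2 u f :=
  ecmul_defined u f /\ square_integrable mu (ecmul u f).

Definition mul_op u : set (L2 mu * L2 mu) :=
  [set p : L2 mu * L2 mu | ecmul_defined u p.1 /\
           (p.2 : X -> R[i]) = ecmul u p.1 %[ae mu]].

Variables (phi : X -> X) (w : X -> R[i]).

Definition mu_w (A : set X) : \bar R := (\int[mu]_(x in A) (csqr (w x))%:E)%E.

Definition wco_well_defined :=
  forall A, measurable A -> mu A = 0%E -> mu_w (phi @^-1` A) = 0%E.

(* the representative p.1 is immaterial when wco_well_defined holds *)
Definition wco : set (L2 mu * L2 mu) :=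
  [set p : L2 mu * L2 mu |
    (p.2 : X -> R[i]) = (fun x => w x * p.1 (phi x)) %[ae mu]].

Definition wco_densely_defined :=
  wco_well_defined /\ hdense (@L2_dot _ _ _ mu) (op_dom wco).

(* h is a version of the Radon-Nikodym derivative of mu_w \o phi^-1 *)
Definition is_wco_density (h : X -> \bar R) :=
  [/\ measurable_fun [set: X] h, forall x, (0 <= h x)%E
    & forall A, measurable A ->
        mu_w (phi @^-1` A) = (\int[mu]_(x in A) h x)%E].

End WeightedComposition.

Arguments mul_op {R d X} mu u _.
Arguments wco {R d X} mu phi w _.

(* Main.v *)
Require Import Defs.
From HB Require Import structures.
From mathcomp Require Import all_boot all_order all_algebra.
From mathcomp Require Import sesquilinear complex ring lra.
From mathcomp Require Import all_classical all_reals all_analysis.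
From mathcomp Require Import measurable_realfun.
Set Implicit Arguments.
Unset Strict Implicit.
Unset Printing Implicit Defensive.
Import Order.TTheory GRing.Theory Num.Theory Num.Def.
Local Open Scope classical_set_scope.
Local Open Scope ring_scope.

(** Write [T] for the weighted composition operator, [S] for the operator
    [f |-> w / (h o phi) * (f o phi)] on its maximal domain, and, for a real
    function [m], [M_m] for multiplication by [m]. The defining property of the
    density, [mu_w o phi^-1 = h mu], says that
    [int |w|^2 (F o phi) dmu = int F h dmu], first for nonnegative F and then,
    by splitting F into positive and negative parts, for complex F
    ([ge0_integral_density_comp], [cintegral_transfer]). The domain of T is dense
    and mu is sigma-finite, so h is finite almost everywhere
    ([density_fin_num]); let H be its finite version. Everything is then read
    off from the identity
    [<w (F o phi), w (G o phi)> = int F conj(G) H dmu] ([dot_weighted]).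

    Modulus. It gives [T^* T = M_H], so [M_(sqrt H)] is a positive selfadjoint
    square root of [T^* T]. It is the only one ([positive_root_unique]): if [A]
    is another and [r = 1 / (1 + H)], then [A r] is a bounded positive operator
    commuting with [r], so its square is multiplication by
    [(sqrt H * r) ^ 2], and the question is reduced to bounded operators, where
    the square root of the square is a uniform limit of polynomials
    ([bounded_root_unique]). Hence [|T| = M_(sqrt H)] ([abs_op_wco]).

    Polar decomposition. The operator [f |-> w / sqrt(h o phi) * (f o phi)] is
    an isometry off the kernel of T, which consists of the functions vanishing
    where H does not, and its composition with [|T|] is T. Since the functions
    in the range of [|T|] approximate every function vanishing where H does, no
    other operator has these properties ([unitary_part_wco]). Multiplying by
    [1 / sqrt(h o phi)] once more gives S, which is the claimed factorization.

    Reciprocal. A computation with the same identity shows that [T^* S f] is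
    the restriction of f to the set where H does not vanish, that is, its
    projection onto the closure of the range of [T^*] ([adjoint_reciprocal]).
    The remaining point is that the range of [T^*] lies in the domain of S: if
    [f = T^* g], testing g against [T k], with k a truncation of [f / H], yields
    [int |f|^2 / H dmu <= |g|^2] ([adjoint_trunc_le], [adjoint_reciprocal_dom]).
    So S satisfies the conditions that characterize the reciprocal of [T^*]
    ([reciprocal_adjoint_wco]); its domain and values are the claimed ones.

    Since [0^-1 = 0] in a field, [fine (h x)^-1 = (fine (h x))^-1] holds also
    where h is 0 or infinite; the conventions of the statement are thus those
    of real inverses of H, and w vanishes almost everywhere on the set where
    [H o phi] does ([ae_weight_density]). *)

(** * Change of variables for a map that transports a weight to a density *)

Section WeightedTransfer.
Context {R : realType} {d : measure_display} {X : measurableType d}.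
Variable mu : {measure set X -> \bar R}.
Local Open Scope ereal_scope.

Import HBNNSimple.

Lemma integral_simple_comp (k : X -> \bar R) (psi : X -> X)
    (s : {nnsfun X >-> R}) :
    measurable_fun setT psi -> measurable_fun setT k -> (forall x, 0 <= k x) ->
  \int[mu]_x ((s (psi x))%:E * k x) =
  \sum_(y \in range s)
    y%:E * \int[mu]_(x in psi @^-1` (s @^-1` [set y])) k x.
Proof.
move=> mpsi mk k0.
have mind y : measurable_fun setT
    (fun x => \1_(s @^-1` [set y]) (psi x) : R).
  exact: (@measurableT_comp _ _ _ _ _ _ (\1_(s @^-1` [set y]) : X -> R)).
transitivity (\int[mu]_x \sum_(y \in range s)
    ((y * \1_(s @^-1` [set y]) (psi x))%:E * k x)).
  apply: eq_integral => x _; rewrite -ge0_mule_fsuml => [|y]; last first.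
    exact: nnfun_muleindic_ge0.
  by rewrite fsumEFin // -fimfunE.
rewrite ge0_integral_fsum//; last 2 first.
- move=> y; apply: emeasurable_funM => //; apply/measurable_EFinP.
  exact: measurable_funM.
- by move=> y x _; rewrite mule_ge0// nnfun_muleindic_ge0.
apply: eq_fsbigr => y yr.
under eq_integral do rewrite EFinM -muleA.
have y0 : (0 <= y)%R by move: yr; rewrite inE => -[t _ <-].
rewrite ge0_integralZl//; last 2 first.
- by apply: emeasurable_funM => //; exact/measurable_EFinP.
- by move=> x _; rewrite mule_ge0 ?lee_fin.
congr (_ * _); rewrite -[in RHS](setTI (psi @^-1` _)) integral_mkcondr.
by apply: eq_integral => x _; rewrite muleC epatch_indic.
Qed.

(** Both sides only see the masses that the two weighted measures give to the
    level sets of a simple function, so that the monotone convergence theorem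
    extends the equality from sets to nonnegative functions. *)
Lemma ge0_integral_density_comp (k h g : X -> \bar R) (psi : X -> X) :
    measurable_fun setT psi ->
    measurable_fun setT k -> (forall x, 0 <= k x) ->
    measurable_fun setT h -> (forall x, 0 <= h x) ->
    (forall A, measurable A ->
      \int[mu]_(x in psi @^-1` A) k x = \int[mu]_(x in A) h x) ->
    measurable_fun setT g -> (forall x, 0 <= g x) ->
  \int[mu]_x (g (psi x) * k x) = \int[mu]_x (g x * h x).
Proof.
move=> mpsi mk k0 mh h0 kh mg g0.
pose s := nnsfun_approx measurableT mg.
have sg x : EFin \o s^~ x @ \oo --> g x.
  by apply: cvg_nnsfun_approx => // y _; exact: g0.
have lims (f : X -> \bar R) (p : X -> X) : measurable_fun setT p ->
    measurable_fun setT f -> (forall x, 0 <= f x) ->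
  \int[mu]_x (g (p x) * f x) =
    limn (fun n => \int[mu]_x ((s n (p x))%:E * f x)).
  move=> mp mf f0; rewrite -monotone_convergence//.
  - apply: eq_integral => x _; apply/esym/cvg_lim => //.
    have [fx|fx] := eqVneq (f x) 0.
      by rewrite fx mule0; under eq_fun do rewrite mule0; exact: cvg_cst.
    have [gx|gx] := eqVneq (g (p x)) 0.
      rewrite gx mul0e; under eq_fun => n.
        rewrite (_ : s n (p x) = 0%R) ?mul0e; last first.
          have : (s n (p x))%:E <= g (p x) by rewrite nnsfun_approxE le_approx.
          by rewrite gx lee_fin => sn; apply/eqP; rewrite eq_le sn /=.
        over.
      exact: cvg_cst.
    have sf : g (p x) *? f x.
      by move: gx fx; case: (g (p x)) (f x) => [?||] [?||].
    exact: (cvgeM sf (sg (p x)) (cvg_cst (f x))).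
  - move=> n; apply: emeasurable_funM => //; apply/measurable_EFinP.
    exact: (@measurableT_comp _ _ _ _ _ _ (s n)).
  - by move=> n x _; rewrite mule_ge0// lee_fin.
  - move=> x _ m n mn; rewrite lee_wpmul2r// lee_fin.
    exact/lefP/nd_nnsfun_approx.
rewrite lims// (lims h id)//; congr (limn _); apply/funext => n.
rewrite !integral_simple_comp//; apply: eq_fsbigr => y _; congr (_ * _).
exact/kh/measurable_funPTI.
Qed.
End WeightedTransfer.

(** * Adjoints and reciprocals in a Hermitian space *)

Section Operators.
Context {C : numClosedFieldType} {H : lmodType C}.
Variable dot : {dot H for conjC}.
Implicit Types (P S T : set (H * H)) (M : set H) (f g u v : H).

Lemma dotC u v : dot u v = conjC (dot v u).
Proof. by rewrite (hermC dot) expr0 mul1r. Qed.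

Lemma dot_eq0C u v : dot u v = 0 -> dot v u = 0.
Proof. by move=> uv; rewrite dotC uv conjC0. Qed.

Lemma dot_sep u v : (forall k, dot k u = dot k v) -> u = v.
Proof.
move=> uv; apply/eqP; rewrite -subr_eq0 -(dnorm_eq0 dot).
by rewrite linearBr /= uv subrr.
Qed.

(** If [dot f q] were nonzero, the points of M would be at distance at least
    [|dot f q| / |q|] from f, since subtracting from f a vector orthogonal to q
    does not change its component along q. *)
Lemma horth_hclosure M f q : hclosure dot M f -> horth dot M q -> dot f q = 0.
Proof.
move=> Mf Mq; apply/eqP; apply: contraT => t0; exfalso.
set t := dot f q in t0.
have q0 : 0 < dot q q.
  rewrite (dnorm_gt0 dot); apply: contra t0 => /eqP q0.
  by rewrite /t q0 (linear0r dot f).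
have e0 : 0 < `|t| / sqrtC (dot q q).
  by rewrite divr_gt0 ?normr_gt0 ?sqrtC_gt0.
have [g Mg] := Mf _ e0; set v := f - g => vlt.
have vq : dot v q = t by rewrite /v linearBl /= (dot_eq0C (Mq _ Mg)) subr0.
have {}vlt : dot v v < `|t| ^+ 2 / dot q q.
  have : hnorm dot v ^+ 2 < (`|t| / sqrtC (dot q q)) ^+ 2.
    by rewrite ltr_pXn2r // nnegrE ?sqrtC_ge0 ?(dnorm_ge0 dot) // ltW.
  by rewrite sqrtCK expr_div_n sqrtCK.
have scaleC (a b : C) : a *: (b : C^o) = a * b by [].
clearbody v; have := dnorm_ge0 dot (v - (t / dot q q) *: q).
rewrite linearBr /= !linearBl /= !linearZr_LR /= !linearZl_LR /= vq.
rewrite (dotC q v) vq fmorph_div /= -[conjC (dot q q)]dotC.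
rewrite mulVf ?gt_eqF // !scaleC mulr1 subrr subr0.
rewrite [_ * conjC t]mulrC mulrA -normCK subr_ge0.
by move=> /(lt_le_trans vlt); rewrite ltxx.
Qed.

Lemma linear_opB T f g f' g' : linear_op T -> T (f, g) -> T (f', g') ->
  T (f - f', g - g').
Proof.
move=> [_ lin _] Tfg Tfg'; have := lin (-1) _ _ _ _ Tfg' Tfg.
by rewrite !scaleN1r addrC [- g' + g]addrC.
Qed.

Lemma adjoint_functional T f g g' : hdense dot (op_dom T) ->
  adjoint dot T (f, g) -> adjoint dot T (f, g') -> g = g'.
Proof.
move=> dT Tg Tg'; apply/eqP; rewrite -subr_eq0 -(dnorm_eq0 dot); apply/eqP.
apply: (@horth_hclosure (op_dom T)); first by rewrite [hclosure _ _]dT.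
move=> k [p Tkp]; rewrite linearBl /= (dotC g) (dotC g').
by rewrite -(Tg _ _ Tkp) -(Tg' _ _ Tkp) subrr.
Qed.

Lemma adjointB T f g f' g' : adjoint dot T (f, g) -> adjoint dot T (f', g') ->
  adjoint dot T (f - f', g - g').
Proof.
by move=> Tf Tf' a b Tab; rewrite /= !linearBr /= (Tf _ _ Tab) (Tf' _ _ Tab).
Qed.

Lemma hproj_horth_unique M f g g' :
  hproj dot (horth dot M) (f, g) -> hproj dot (horth dot M) (f, g') -> g = g'.
Proof.
move=> [/= Mg Mfg] [/= Mg' Mfg'].
apply/eqP; rewrite -subr_eq0 -(dnorm_eq0 dot).
have Mgg : horth dot M (g - g').
  by move=> k Mk; rewrite linearBl /= (Mg _ Mk) (Mg' _ Mk) subrr.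
rewrite {1}(_ : g - g' = (f - g') - (f - g)); last first.
  by rewrite opprB [RHS]addrC addrA subrK.
by rewrite linearBl /= Mfg // Mfg' // subrr.
Qed.

(** On the range of P the reciprocal is prescribed by its composition with P,
    on the orthogonal complement of the range it vanishes, and its domain is
    the sum of these two subspaces. *)
Lemma reciprocal_unique P S S' :
  (forall f g g', P (f, g) -> P (f, g') -> g = g') ->
  is_reciprocal dot P S -> is_reciprocal dot P S' -> S = S'.
Proof.
move=> Pfun.
suff sub S1 S2 : is_reciprocal dot P S1 -> is_reciprocal dot P S2 ->
    S1 `<=` S2 by move=> rS rS'; apply/seteqP; split; exact: sub.
move=> [[[_ lin1 fun1] _] dom1 _ SP1 ker1] [[[_ lin2 fun2] _] dom2 _ SP2 ker2].
move=> [f a] Sfa; have : op_dom S1 f by exists a.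
rewrite dom1 => -[p [k [[g Pgp] Rk fpk]]].
have domg : op_dom P g by exists p.
have S1k : S1 (k, 0) by rewrite -[S1 _]/(op_ker S1 k) ker1.
have S2k : S2 (k, 0) by rewrite -[S2 _]/(op_ker S2 k) ker2.
have [b1 pb1 [k1 /= [Pk1 S1b]]] := SP1 _ domg.
have [b2 pb2 [k2 /= [Pk2 S2b]]] := SP2 _ domg.
rewrite -(Pfun _ _ _ Pgp Pk1) in S1b; rewrite -(Pfun _ _ _ Pgp Pk2) in S2b.
rewrite (hproj_horth_unique pb2 pb1) in S2b.
have := lin1 1 _ _ _ _ S1b S1k; rewrite !scale1r addr0 -fpk => S1f.
have := lin2 1 _ _ _ _ S2b S2k; rewrite !scale1r addr0 -fpk => S2f.
by rewrite (fun1 _ _ _ Sfa S1f).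
Qed.

End Operators.

Local Notation "x %:C" := (real_complex _ x) : ring_scope.

(** * Real and complex measurable functions *)

Section RealAndComplexFunctions.
Context {R : realType} {d : measure_display} {X : measurableType d}.
Implicit Types (a : R) (z : R[i]) (m : X -> R) (F : X -> R[i]).

Lemma funeposM_real (k : X -> R) (F : X -> R) : (forall x, 0 <= k x) ->
  ((fun x => (F x * k x)%:E)^\+ = fun x => maxe (F x)%:E 0 * (k x)%:E)%E.
Proof.
move=> k0; apply/funext => x; rewrite !funeposE -!EFin_max -EFinM.
by rewrite maxr_pMl // mul0r.
Qed.

Lemma funenegM_real (k : X -> R) (F : X -> R) : (forall x, 0 <= k x) ->
  ((fun x => (F x * k x)%:E)^\- = fun x => maxe (- F x)%:E 0 * (k x)%:E)%E.
Proof.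
move=> k0; apply/funext => x; rewrite !funenegE -!EFinN -!EFin_max -EFinM.
by rewrite maxr_pMl // mul0r mulNr.
Qed.

Lemma measurable_sqrt m : measurable_fun setT m ->
  measurable_fun setT (fun x => Num.sqrt (m x)).
Proof.
move=> mm; apply: measurableT_comp mm.
by apply: continuous_measurable_fun; exact: sqrt_continuous.
Qed.

Lemma measurable_inv m : measurable_fun setT m -> (forall x, 0 <= m x) ->
  measurable_fun setT (fun x => (m x)^-1).
Proof.
move=> mm m0; rewrite (_ : (fun _ => _) = (fun x => m x `^ (-1))).
  exact: measurableT_comp (measurable_powR (-1)) mm.
by apply/funext => x; rewrite powR_inv1.
Qed.

Lemma conjC_real a : conjC (a%:C : R[i]) = a%:C.
Proof. by apply/eqP; rewrite eq_complex /= oppr0 !eqxx. Qed.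

Lemma csqr_realM a z : csqr (a%:C * z) = a ^+ 2 * csqr z.
Proof. by case: z => u v; rewrite /csqr/=; ring. Qed.

Lemma cmeasurable_real m : measurable_fun setT m ->
  cmeasurable (fun x => (m x)%:C).
Proof. by move=> mm; split => //; exact: measurable_cst. Qed.

Lemma cmeasurable_realM m F : measurable_fun setT m -> cmeasurable F ->
  cmeasurable (fun x => (m x)%:C * F x).
Proof. by move=> mm mF; apply: cmeasurableM => //; exact: cmeasurable_real. Qed.

Lemma cmeasurable_comp (psi : X -> X) F : measurable_fun setT psi ->
  cmeasurable F -> cmeasurable (fun x => F (psi x)).
Proof.
by move=> mpsi [mF1 mF2]; split; [move: mF1|move: mF2] => mF;
  exact: (measurableT_comp mF).
Qed.

Lemma cmeasurable_mulC F G : cmeasurable F -> cmeasurable G ->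
  cmeasurable (fun x => F x * conjC (G x)).
Proof. by move=> mF mG; apply: cmeasurableM => //; exact: cmeasurableC. Qed.

End RealAndComplexFunctions.

(** * Square integrable functions modulo almost everywhere equality *)

Section L2Theory.
Context {R : realType} {d : measure_display} {X : measurableType d}.
Variable mu : {measure set X -> \bar R}.
Implicit Types (F G : X -> R[i]) (u v f g : L2 mu) (m n : X -> R).

Lemma L2_cmeasurable u : cmeasurable u.
Proof. by case: (L2_square_integrable u). Qed.

Lemma ae_trueP F G : F = G %[ae mu] <-> {ae mu, forall x, F x = G x}.
Proof. by split; apply: filterS => x //; exact. Qed.

Lemma L2_ae_ext u v : {ae mu, forall x, u x = v x} -> u = v.
Proof. by move=> uv; apply/L2_eqP/ae_trueP. Qed.

Lemma L2_aeD u v : {ae mu, forall x, (u + v : L2 mu) x = u x + v x}.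
Proof. exact/ae_trueP/L2_funD. Qed.

Lemma L2_aeZ a u : {ae mu, forall x, (a *: u : L2 mu) x = a * u x}.
Proof. exact/ae_trueP/L2_scaleE. Qed.

Lemma L2_aeB u v : {ae mu, forall x, (u - v : L2 mu) x = u x - v x}.
Proof.
rewrite -scaleN1r; apply: filterS2 (L2_aeD u (-1 *: v)) (L2_aeZ (-1) v) => x.
by move=> -> ->; rewrite mulN1r.
Qed.

Lemma L2_ae0 : {ae mu, forall x, (0 : L2 mu) x = 0}.
Proof.
rewrite -(scale0r (0 : L2 mu)); apply: filterS (L2_aeZ 0 0) => x ->.
by rewrite mul0r.
Qed.

(** The value 0 outside of the square integrable functions makes this a total
    function, so that operators can be written without carrying proofs. *)
Definition toL2 F : L2 mu :=
  if pselect (square_integrable mu F) is left LF then L2_mk LF else 0.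

Lemma toL2E F : square_integrable mu F -> {ae mu, forall x, toL2 F x = F x}.
Proof.
by rewrite /toL2 => LF; case: pselect => // p; exact/ae_trueP/L2_mkE.
Qed.

Lemma eq_ae_integral_csqr F G : cmeasurable F -> cmeasurable G ->
  {ae mu, forall x, F x = G x} ->
  (\int[mu]_x (csqr (F x))%:E = \int[mu]_x (csqr (G x))%:E)%E.
Proof.
move=> mF mG FG; apply: ae_eq_integral => //.
- by apply/measurable_EFinP; exact: measurable_csqr.
- by apply/measurable_EFinP; exact: measurable_csqr.
- by apply: filterS FG => x ->.
Qed.

Lemma square_integrable_ae F G : cmeasurable F -> square_integrable mu G ->
  {ae mu, forall x, F x = G x} -> square_integrable mu F.
Proof.
by move=> mF [mG LG] FG; split => //; rewrite (eq_ae_integral_csqr mF mG FG).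
Qed.

Lemma square_integrable_realM m (c : R) u : measurable_fun setT m ->
  (forall x, `|m x| <= c) -> square_integrable mu (fun x => (m x)%:C * u x).
Proof.
move=> mm mc; have Lu := L2_square_integrable u.
apply: (square_integrable_le (a := c ^+ 2) (b := 0) _ Lu Lu).
  by apply: cmeasurable_realM => //; exact: L2_cmeasurable.
move=> x; rewrite csqr_realM mul0r addr0 ler_wpM2r ?csqr_ge0 //.
rewrite -[m x ^+ 2]real_normK ?num_real // lerXn2r // nnegrE //.
exact: le_trans (mc x).
Qed.

Definition L2dot : {dot (L2 mu) for conjC} := @L2_dot R d X mu.

Definition sqnorm u : R := Rintegral mu setT (fun x => csqr (u x)).

Lemma sqnormE u : (sqnorm u)%:E = (\int[mu]_x (csqr (u x))%:E)%E.
Proof.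
rewrite /sqnorm /Rintegral fineK //.
by apply: integrable_fin_num => //; exact/integrable_csqr/L2_square_integrable.
Qed.

Lemma sqnorm_ae u F : cmeasurable F -> {ae mu, forall x, u x = F x} ->
  (sqnorm u)%:E = (\int[mu]_x (csqr (F x))%:E)%E.
Proof.
move=> mF uF; rewrite sqnormE; apply: eq_ae_integral_csqr => //.
exact: L2_cmeasurable.
Qed.

Lemma dot_sqnorm u : L2dot u u = (sqnorm u)%:C.
Proof.
rewrite /L2dot /L2_dot /cintegral /=; congr (_ +i* _)%C.
  by apply: eq_Rintegral => x _; rewrite -csqrE.
rewrite /Rintegral; under eq_integral do rewrite -csqrE /=.
by rewrite integral0.
Qed.

Lemma sqnorm_ge0 u : 0 <= sqnorm u.
Proof. by apply: Rintegral_ge0 => x _; exact: csqr_ge0. Qed.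

Lemma sqnorm_eq0 u : sqnorm u = 0 -> u = 0.
Proof. by move=> u0; apply/eqP; rewrite -(dnorm_eq0 L2dot) dot_sqnorm u0. Qed.

Lemma sqnorm0 : sqnorm 0 = 0.
Proof. by apply: complexI; rewrite -dot_sqnorm linear0l. Qed.

Lemma sqnormB_le u v : sqnorm (u - v) <= 2 * (sqnorm u + sqnorm v).
Proof.
rewrite -lecR rmorphM /= -dot_sqnorm.
rewrite -[leLHS]addr0 -[leRHS](_ : L2dot (u - v) (u - v) +
    L2dot (u + v) (u + v) = _); first by rewrite lerD2l dnorm_ge0.
rewrite dnormB dnormD !dot_sqnorm !rmorphD /= rmorph1; ring.
Qed.

Lemma hnorm_eq u v : sqnorm u = sqnorm v -> hnorm L2dot u = hnorm L2dot v.
Proof. by move=> uv; rewrite /hnorm !dot_sqnorm uv. Qed.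

Lemma hnorm_sqnorm u v : hnorm L2dot u = hnorm L2dot v -> sqnorm u = sqnorm v.
Proof.
move=> /(congr1 (fun z => z ^+ 2)); rewrite !sqrtCK !dot_sqnorm.
exact: complexI.
Qed.

Lemma hclosureP (M : set (L2 mu)) f : hclosure L2dot M f <->
  forall e : R, 0 < e -> exists2 g, M g & sqnorm (f - g) < e.
Proof.
split=> [Mf e e0|Mf [e e'] e0].
  have [|g Mg fg] := Mf (sqrtC (e%:C)); first by rewrite sqrtC_gt0 ltcR.
  exists g => //; rewrite -ltcR -dot_sqnorm.
  by rewrite -ltr_sqrtC // nnegrE ?dnorm_ge0 // lecR ltW.
have ? : e' = 0 by move: e0; rewrite ltcE /= => /andP[/eqP].
subst e'; have {}e0 : 0 < e by rewrite -ltcR.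
have [|g Mg fg] := Mf (e ^+ 2); first by rewrite exprn_gt0.
exists g => //; rewrite /hnorm dot_sqnorm.
have ec : 0 <= e%:C by rewrite lecR ltW.
rewrite -[ltRHS](sqrCK ec) ltr_sqrtC ?nnegrE ?exprn_ge0 // ?lecR ?sqnorm_ge0 //.
by rewrite -rmorphXn /= ltcR.
Qed.

Lemma eq_dot u v f g :
  {ae mu, forall x, u x * conjC (v x) = f x * conjC (g x)} ->
  L2dot u v = L2dot f g.
Proof.
move=> uvfg; apply: eq_ae_cintegral; last exact/ae_trueP.
  by apply: cmeasurable_mulC; exact: L2_cmeasurable.
by apply: cmeasurable_mulC; exact: L2_cmeasurable.
Qed.

Lemma dot_ae u v F : cmeasurable F ->
  {ae mu, forall x, u x * conjC (v x) = F x} -> L2dot u v = cintegral mu F.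
Proof.
move=> mF uvF; apply: eq_ae_cintegral => //; last exact/ae_trueP.
by apply: cmeasurable_mulC; exact: L2_cmeasurable.
Qed.

Definition bounded_mult m :=
  measurable_fun setT m /\ exists c : R, forall x, `|m x| <= c.

Lemma bounded_mult_cst (c : R) : bounded_mult (fun=> c).
Proof. by split; [exact: measurable_cst|exists `|c|]. Qed.

Lemma bounded_multM m n : bounded_mult m -> bounded_mult n ->
  bounded_mult (fun x => m x * n x).
Proof.
move=> [mm [c mc]] [mn [e ne]]; split; first exact: measurable_funM.
by exists (c * e) => x; rewrite normrM ler_pM.
Qed.

Lemma bounded_multB m n : bounded_mult m -> bounded_mult n ->
  bounded_mult (fun x => m x - n x).
Proof.
move=> [mm [c mc]] [mn [e ne]]; split; first exact: measurable_funB.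
by exists (c + e) => x; rewrite (le_trans (ler_normB _ _)) // lerD.
Qed.

Definition multL2 m u : L2 mu := toL2 (fun x => (m x)%:C * u x).

Lemma multL2E m u : bounded_mult m ->
  {ae mu, forall x, multL2 m u x = (m x)%:C * u x}.
Proof.
by move=> [mm [c mc]]; apply: toL2E; exact: square_integrable_realM mc.
Qed.

Lemma multL2_linear m a u v : bounded_mult m ->
  multL2 m (a *: u + v) = a *: multL2 m u + multL2 m v.
Proof.
move=> bm; apply: L2_ae_ext.
have E1 := multL2E (a *: u + v) bm; have E2 := multL2E u bm.
have E3 := multL2E v bm; have E4 := L2_aeD (a *: u) v.
have E5 := L2_aeZ a u; have E6 := L2_aeD (a *: multL2 m u) (multL2 m v).
have E7 := L2_aeZ a (multL2 m u).
near=> x; rewrite (near E1 x) // (near E4 x) // (near E5 x) // (near E6 x) //.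
rewrite (near E7 x) // (near E2 x) // (near E3 x) //; ring.
Unshelve. all: by end_near. Qed.

Lemma multL2_0 m : bounded_mult m -> multL2 m 0 = 0.
Proof.
move=> bm; have := multL2_linear 1 0 0 bm.
by rewrite scaler0 addr0 scale1r -{1}[multL2 m 0]addr0 => /addrI.
Qed.

Lemma multL2B m u v : bounded_mult m ->
  multL2 m (u - v) = multL2 m u - multL2 m v.
Proof.
by move=> bm; rewrite -scaleN1r addrC multL2_linear // scaleN1r addrC.
Qed.

Lemma multL2_comp m n u : bounded_mult m -> bounded_mult n ->
  multL2 m (multL2 n u) = multL2 (fun x => m x * n x) u.
Proof.
move=> bm bn; apply: L2_ae_ext; have bmn := bounded_multM bm bn.
apply: filterS3 (multL2E (multL2 n u) bm) (multL2E u bn) (multL2E u bmn) => x.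
by move=> -> -> ->; rewrite rmorphM mulrA.
Qed.

Lemma multL2_comm m n u : bounded_mult m -> bounded_mult n ->
  multL2 m (multL2 n u) = multL2 n (multL2 m u).
Proof.
move=> bm bn; rewrite (multL2_comp u bm bn) (multL2_comp u bn bm).
by congr (multL2 _ u); apply/funext => x; rewrite mulrC.
Qed.

Lemma multL2_dot m u v : bounded_mult m ->
  L2dot (multL2 m u) v = L2dot u (multL2 m v).
Proof.
move=> bm; apply: eq_dot; apply: filterS2 (multL2E u bm) (multL2E v bm) => x.
by move=> -> ->; rewrite (rmorphM conjC) /= conjC_real; ring.
Qed.

Lemma sqnorm_multL2_le m (c : R) u : measurable_fun setT m ->
  (forall x, `|m x| <= c) -> sqnorm (multL2 m u) <= c ^+ 2 * sqnorm u.
Proof.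
move=> mm mc; have bm : bounded_mult m by split => //; exists c.
rewrite -lee_fin EFinM (sqnorm_ae _ (multL2E u bm)); last first.
  by apply: cmeasurable_realM => //; exact: L2_cmeasurable.
rewrite sqnormE.
have mu2 := measurable_csqr (L2_cmeasurable u).
rewrite -ge0_integralZl ?lee_fin ?sqr_ge0 //; last 2 first.
- exact/measurable_EFinP.
- by move=> x _; rewrite lee_fin csqr_ge0.
apply: ge0_le_integral => //.
- by move=> x _; rewrite lee_fin csqr_ge0.
- apply/measurable_EFinP/measurable_csqr/cmeasurable_realM => //.
  exact: L2_cmeasurable.
- by apply/measurable_EFinP/measurable_funM.
move=> x _; rewrite -EFinM lee_fin csqr_realM ler_wpM2r ?csqr_ge0 //.
rewrite -[m x ^+ 2]real_normK ?num_real // lerXn2r // nnegrE //.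
exact: le_trans (mc x).
Qed.

End L2Theory.

(** * Square roots of bounded multiplication operators *)

Section BoundedRoot.
Context {R : realType} {d : measure_display} {X : measurableType d}.
Variable mu : {measure set X -> \bar R}.
Implicit Types (u v : L2 mu).

(** These polynomials in [s ^+ 2] converge uniformly to s when s has values in
    the unit interval; a bounded operator commuting with multiplication by
    [s ^+ 2] therefore commutes with multiplication by s. *)
Fixpoint sqrt_iter (s : X -> R) (k : nat) : X -> R :=
  if k is k'.+1 then
    fun x => sqrt_iter s k' x + 2^-1 * (s x ^+ 2 - sqrt_iter s k' x ^+ 2)
  else fun=> 0.

(** The error e lies between 0 and s, and the next one is
    [e * (1 - s + e / 2)], at most [e * (1 - e / 2)], whence the rate
    [2 / (k + 2)]. *)
Lemma sqrt_iter_bound s k x : 0 <= s x <= 1 ->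
  0 <= s x - sqrt_iter s k x <= 2 / k.+2%:R.
Proof.
move=> /andP[s0 s1].
suff : [/\ 0 <= s x - sqrt_iter s k x, sqrt_iter s k x >= 0
    & s x - sqrt_iter s k x <= 2 / k.+2%:R] by move=> [-> _ ->].
elim: k => [|k [IH0 IHs IHk]] /=; first by rewrite subr0 divff.
set q := sqrt_iter s k x in IH0 IHs IHk *.
set c := 2 / k.+2%:R in IHk *.
have k0 : (0 : R) < k.+2%:R by rewrite ltr0n.
have k30 : (0 : R) < k.+3%:R by rewrite ltr0n.
have c1 : c <= 1 by rewrite ler_pdivrMr // mul1r (ler_nat _ 2).
have e1 : s x - q <= 1 by lra.
split; [nra|nra|].
apply: (@le_trans _ _ (c * (1 - c / 2))); first by nra.
rewrite /c ler_pdivlMr // -subr_ge0.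
rewrite (_ : _ - _ = 2 / k.+2%:R ^+ 2); last first.
  by rewrite -[k.+3%:R]natr1; field; rewrite gt_eqF.
by rewrite divr_ge0 // exprn_ge0 // ltW.
Qed.

Lemma bounded_sqrt_iter s k : bounded_mult s -> bounded_mult (sqrt_iter s k).
Proof.
move=> bs; elim: k => [|k IH] /=.
  exact: bounded_mult_cst.
rewrite (_ : (fun _ => _) = (fun x => sqrt_iter s k x - (- 2^-1) *
    (s x * s x - sqrt_iter s k x * sqrt_iter s k x))); last first.
  by apply/funext => x; rewrite mulNr opprK !expr2.
apply: bounded_multB => //; apply: bounded_multM.
  exact: bounded_mult_cst.
by apply: bounded_multB; exact: bounded_multM.
Qed.

(** B commutes with its square, hence with the uniform limit s of polynomials in
    [s ^+ 2]; then [y = (B - s) u] satisfies [(B + s) y = 0], so by positivity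
    [B y = s y = 0] and y is orthogonal to itself. *)
Lemma bounded_root_unique (s : X -> R) (B : L2 mu -> L2 mu) :
    bounded_mult s -> (forall x, 0 <= s x <= 1) ->
    (forall a u v, B (a *: u + v) = a *: B u + B v) ->
    (forall u v, L2dot mu (B u) v = L2dot mu u (B v)) ->
    (forall u, 0 <= L2dot mu (B u) u) ->
    (forall u, B (B u) = multL2 (fun x => s x * s x) u) ->
  forall u, B u = multL2 s u.
Proof.
move=> bs s01 Blin Bsym Bpos BB.
have bss := bounded_multM bs bs.
have B0 : B 0 = 0.
  by have := Blin 1 0 0; rewrite !scale1r addr0 -{1}[B 0]addr0 => /addrI.
have BB1 u v : B (u - v) = B u - B v.
  by rewrite -scaleN1r addrC Blin scaleN1r addrC.
have NB u : sqnorm (B u) = sqnorm (multL2 s u).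
  apply: complexI; rewrite -!dot_sqnorm Bsym BB -(multL2_comp _ bs bs).
  by rewrite multL2_dot.
have qB k u : B (multL2 (sqrt_iter s k) u) = multL2 (sqrt_iter s k) (B u).
  elim: k u => [|k IH] u.
    have m0 v : multL2 (sqrt_iter s 0) v = 0.
      apply: L2_ae_ext; apply: filterS2 (L2_ae0 mu)
        (multL2E v (bounded_sqrt_iter 0 bs)) => x -> ->.
      by rewrite mul0r.
    by rewrite !m0 B0.
  have bq := bounded_sqrt_iter k bs; have bq1 := bounded_sqrt_iter k.+1 bs.
  have step v : multL2 (sqrt_iter s k.+1) v =
      multL2 (sqrt_iter s k) v + (2^-1)%:C *: (multL2 (fun x => s x * s x) v
        - multL2 (sqrt_iter s k) (multL2 (sqrt_iter s k) v)).
    rewrite multL2_comp //; apply: L2_ae_ext.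
    have bqq := bounded_multM bq bq.
    have E1 := multL2E v bq1; have E2 := multL2E v bq.
    have E3 := multL2E v bss; have E4 := multL2E v bqq.
    set a := multL2 _ v in E1 *; set b := multL2 _ v in E2 *.
    set c := multL2 _ v in E3 *; set e := multL2 _ v in E4 *.
    have E5 := L2_aeD b ((2^-1)%:C *: (c - e)).
    have E6 := L2_aeZ (2^-1)%:C (c - e).
    have E7 := L2_aeB c e.
    near=> x; rewrite (near E1 x) // (near E5 x) // (near E6 x) //.
    rewrite (near E7 x) // (near E2 x) // (near E3 x) // (near E4 x) //=.
    by rewrite !expr2 rmorphD !rmorphM rmorphB !rmorphM /=; ring.
  rewrite !step addrC Blin BB1 !IH addrC; congr (_ + _ *: (_ - _)).
  by rewrite -!BB.
have sBC u : B (multL2 s u) = multL2 s (B u).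
  apply/eqP; rewrite -subr_eq0; apply/eqP/sqnorm_eq0/eqP; rewrite eq_le.
  rewrite sqnorm_ge0 andbT leNgt; apply/negP.
  set D := _ - _ => D0.
  set K := 2 * (sqnorm u + sqnorm (B u)).
  have Dk k : sqnorm D <= 2 / k.+2%:R * K.
    have bq := bounded_sqrt_iter k bs.
    set q := sqrt_iter s k in bq.
    have sq v : multL2 s v - multL2 q v = multL2 (fun x => s x - q x) v.
      apply: L2_ae_ext; apply: filterS3 (L2_aeB (multL2 s v) (multL2 q v))
        (filterI (multL2E v bs) (multL2E v bq))
        (multL2E v (bounded_multB bs bq)) => x -> [-> ->] ->.
      by rewrite rmorphB mulrBl.
    have -> : D = B (multL2 (fun x => s x - q x) u)
        - multL2 (fun x => s x - q x) (B u).
      by rewrite -!sq BB1 qB opprB addrA subrK.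
    have small v : sqnorm (multL2 (fun x => s x - q x) v) <=
        2 / k.+2%:R * sqnorm v.
      apply: (@le_trans _ _ ((2 / k.+2%:R) ^+ 2 * sqnorm v)).
        apply: sqnorm_multL2_le; first by case: bs bq => ? _ [? _];
          exact: measurable_funB.
        move=> x; have /andP[? ?] := sqrt_iter_bound k (s01 x).
        by rewrite ger0_norm.
      rewrite ler_wpM2r ?sqnorm_ge0 // expr2 ler_piMr ?divr_ge0 //.
      by rewrite ler_pdivrMr // mul1r (ler_nat _ 2).
    have Bsmall v : sqnorm (B v) <= sqnorm v.
      rewrite NB -[leRHS]mul1r -[X in X * _](expr1n _ 2).
      apply: sqnorm_multL2_le; first by case: bs.
      by move=> x; have /andP[? ?] := s01 x; rewrite ger0_norm.
    apply: le_trans (sqnormB_le _ _) _; rewrite /K mulrCA ler_wpM2l //.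
    rewrite mulrDr lerD //; exact: le_trans (Bsmall _) (small _).
  have := Dk (truncn (2 * K / sqnorm D)).
  set k := truncn _; have kgt : 2 * K / sqnorm D < k.+1%:R.
    exact: truncnS_gt.
  rewrite leNgt => /negP; apply.
  rewrite ltr_pdivrMr // in kgt.
  rewrite mulrAC ltr_pdivrMr // [ltRHS]mulrC; apply: lt_le_trans kgt _.
  by rewrite ler_wpM2r ?(ltW D0) // ler_nat.
move=> u; apply/eqP; rewrite -subr_eq0; apply/eqP; set y := _ - _.
(* The square root of s turns [<s y, y> = 0] into [s y = 0]. *)
have bsq : bounded_mult (fun x => Num.sqrt (s x)).
  split; first exact: measurable_sqrt bs.1.
  exists 1 => x; rewrite ger0_norm ?sqrtr_ge0 // -sqrtr1 ler_sqrt //.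
  by case/andP: (s01 x).
set rs := (fun x => Num.sqrt (s x)) in bsq.
have srs v : multL2 s v = multL2 rs (multL2 rs v).
  rewrite multL2_comp //; congr (multL2 _ v); apply/funext => x.
  by rewrite -expr2 sqr_sqrtr //; case/andP: (s01 x).
have yBs : B y + multL2 s y = 0.
  rewrite /y BB1 multL2B // BB multL2_comp // sBC.
  by rewrite addrC addrA subrK subrr.
have sy : multL2 s y = 0.
  suff : L2dot mu (multL2 rs y) (multL2 rs y) = 0.
    move=> /eqP; rewrite (dnorm_eq0 (L2dot mu)) srs => /eqP ->.
    exact: multL2_0.
  apply/eqP; rewrite eq_le (dnorm_ge0 (L2dot mu)) andbT multL2_dot // -srs.
  have := congr1 (fun z => L2dot mu z y) yBs.
  rewrite linearDl /= linear0l multL2_dot // => /eqP.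
  rewrite addrC addr_eq0 => /eqP ->; rewrite oppr_le0. exact: Bpos.
have By : B y = 0.
  apply: sqnorm_eq0; apply: complexI.
  by rewrite -dot_sqnorm Bsym BB -(multL2_comp _ bs bs) sy multL2_0 //
    linear0r.
apply/eqP; rewrite -(dnorm_eq0 (L2dot mu)) {2}/y linearBr /=.
by rewrite -Bsym -multL2_dot // By sy !linear0l subrr.
Unshelve. all: by end_near. Qed.
End BoundedRoot.

(** * Weighted composition and multiplication operators *)

Section WeightedCompositionGraphs.
Context {R : realType} {d : measure_display} {X : measurableType d}.
Variable mu : {measure set X -> \bar R}.
Implicit Types (f g u : L2 mu) (m : X -> R) (psi : X -> X) (v : X -> R[i]).

Lemma wcoP psi v f g : wco mu psi v (f, g) <->
  {ae mu, forall x, g x = v x * f (psi x)}.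
Proof. exact: ae_trueP. Qed.

(** The condition under which the value of [v x * f (psi x)] only depends on
    the class of f modulo equality almost everywhere. *)
Definition nonsingular psi v := forall P : X -> Prop,
  {ae mu, forall x, P x} -> {ae mu, forall x, v x = 0 \/ P (psi x)}.

Lemma nonsingular_eq psi v (F G : X -> R[i]) : nonsingular psi v ->
  {ae mu, forall x, F x = G x} ->
  {ae mu, forall x, v x * F (psi x) = v x * G (psi x)}.
Proof.
move=> ns FG; apply: filterS (ns _ FG) => x [->|->//].
by rewrite !mul0r.
Qed.

Lemma nonsingular_id v : nonsingular id v.
Proof. by move=> P; apply: filterS => x Px; right. Qed.

Lemma wco_linear psi v : nonsingular psi v -> linear_op (wco mu psi v).
Proof.
move=> ns; split.
- apply/wcoP; have E1 := nonsingular_eq ns (L2_ae0 mu).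
  by apply: filterS2 (L2_ae0 mu) E1 => x -> ->; rewrite mulr0.
- move=> a f g f' g' /wcoP E1 /wcoP E2; apply/wcoP.
  have E3 := nonsingular_eq ns (L2_aeD (a *: f) f').
  have E4 := nonsingular_eq ns (L2_aeZ a f).
  have E5 := L2_aeD (a *: g) g'; have E6 := L2_aeZ a g.
  near=> x; rewrite (near E5 x) // (near E6 x) // (near E3 x) // mulrDr.
  by rewrite (near E4 x) // (near E1 x) // (near E2 x) // mulrCA.
move=> f g g' /wcoP E1 /wcoP E2; apply: L2_ae_ext.
by apply: filterS2 E1 E2 => x -> ->.
Unshelve. all: by end_near. Qed.

(** Composing with the identity makes the maximal multiplication operator an
    instance of a weighted composition operator. *)
Definition multop m := wco mu id (fun x => (m x)%:C).

Lemma multopP m f g :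
  multop m (f, g) <-> {ae mu, forall x, g x = (m x)%:C * f x}.
Proof. exact: wcoP. Qed.

Lemma multop_ex m f : square_integrable mu (fun x => (m x)%:C * f x) ->
  exists g, multop m (f, g).
Proof.
by move=> Lf; exists (toL2 mu (fun x => (m x)%:C * f x)); exact/multopP/toL2E.
Qed.

Lemma multop_sym m f g f' g' : multop m (f, g) -> multop m (f', g') ->
  L2dot mu g f' = L2dot mu f g'.
Proof.
move=> /multopP E1 /multopP E2; apply: eq_dot; apply: filterS2 E1 E2 => x.
by move=> -> ->; rewrite (rmorphM conjC) /= conjC_real mulrCA mulrA.
Qed.

(** The bounded multipliers r and [m * r] turn an equation between everywhere
    defined operators into membership in the graph of an unbounded one. *)
Lemma multop_cancel m (r : X -> R) f g : bounded_mult r ->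
  bounded_mult (fun x => m x * r x) -> (forall x, r x != 0) ->
  multL2 (fun x => m x * r x) f = multL2 r g -> multop m (f, g).
Proof.
move=> br bmr r0 E; have := multL2E f bmr; rewrite E => E1.
apply/multopP; apply: filterS2 E1 (multL2E g br) => x -> /eqP.
rewrite rmorphM /= [(m x)%:C * _]mulrC -mulrA eq_sym.
have rx : (r x)%:C != 0 :> R[i] by rewrite fmorph_eq0.
by move=> /eqP /(mulfI rx).
Qed.

(** The test functions [r * u], with u arbitrary, lie in the domain; they are
    enough to recover g from its scalar products. *)
Lemma multop_adjoint m (r : X -> R) : bounded_mult r ->
  bounded_mult (fun x => m x * r x) -> (forall x, r x != 0) ->
  adjoint (L2dot mu) (multop m) = multop m.
Proof.
move=> br bmr r0; apply/seteqP; split=> -[f g] /=; last first.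
  by move=> fg a b ab; exact: multop_sym ab fg.
move=> fg; apply: (multop_cancel br bmr r0).
apply: (dot_sep (dot := L2dot mu)) => u.
rewrite -!multL2_dot //; apply: fg; apply/multopP.
apply: filterS2 (multL2E u br) (multL2E u bmr) => x -> ->.
by rewrite rmorphM mulrA.
Qed.

(** Dominated convergence, in the form of approximation by truncations. *)
Lemma truncation_approx (t : nat -> X -> R) (u : L2 mu) (e : R) :
    (forall n, measurable_fun setT (t n)) -> (forall n x, 0 <= t n x <= 1) ->
    (forall x, \forall n \near \oo, t n x = 1) -> 0 < e ->
  exists n, sqnorm (u - multL2 (t n) u) < e.
Proof.
move=> mt t01 t1 e0.
have bt n : bounded_mult (t n).
  by split => //; exists 1 => x; have /andP[? ?] := t01 n x; rewrite ger0_norm.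
pose F n x : \bar R := (csqr ((1 - t n x)%:C * u x))%:E.
have mtu n : cmeasurable (fun x => (1 - t n x)%:C * u x).
  apply: cmeasurable_realM; last exact: L2_cmeasurable.
  by apply: measurable_funB => //; exact: measurable_cst.
have FE n : (sqnorm (u - multL2 (t n) u))%:E = (\int[mu]_x F n x)%E.
  apply: sqnorm_ae => //.
  apply: filterS2 (L2_aeB u (multL2 (t n) u)) (multL2E u (bt n)) => x -> ->.
  by rewrite rmorphB rmorph1 mulrBl mul1r.
have [_ _] : [/\ mu.-integrable setT (cst 0%E),
    (\int[mu]_x `|F n x - cst 0 x| @[n --> \oo] --> 0)%E &
    (\int[mu]_x F n x @[n --> \oo] --> \int[mu]_x cst 0 x)%E].
  apply: (@dominated_convergence _ _ _ mu setT measurableT F _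
    (fun x => (csqr (u x))%:E)) => //.
  - by move=> n; apply/measurable_EFinP/measurable_csqr.
  - apply: nearW => x _; apply: cvg_near_cst.
    apply: filterS (t1 x) => n tn; rewrite /F tn subrr mul0r.
    by rewrite /csqr /= expr0n addr0.
  - exact/integrable_csqr/L2_square_integrable.
  - apply: nearW => x n _; rewrite /F gee0_abs ?lee_fin ?csqr_ge0 //.
    rewrite csqr_realM ler_piMl ?csqr_ge0 //.
    by have /andP[? ?] := t01 n x; nra.
rewrite integral0 => /fine_cvgP[_ /cvgrPdist_lt /(_ _ e0)].
move=> [N _ /(_ N (leqnn N))] /=; rewrite sub0r normrN -FE /= => NE.
by exists N; rewrite (le_lt_trans _ NE) // ler_norm.
Qed.

End WeightedCompositionGraphs.

Arguments multop {R d X} mu m _.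

(** * Uniqueness of the positive square root of a multiplication operator *)

Section UnboundedRoot.
Context {R : realType} {d : measure_display} {X : measurableType d}.
Variable mu : {measure set X -> \bar R}.
Implicit Types (f g u : L2 mu).
Variable H : X -> R.
Hypothesis mH : measurable_fun [set: X] H.
Hypothesis H0 : forall x, 0 <= H x.

(** The resolvent of multiplication by H at -1. *)
Definition res x := (1 + H x)^-1.

Let H1 x : 0 < 1 + H x.
Proof. by rewrite ltr_wpDr. Qed.

Lemma res_neq0 x : res x != 0.
Proof. by rewrite invr_eq0 gt_eqF. Qed.

Lemma measurable_res : measurable_fun setT res.
Proof.
apply: measurable_inv; last by move=> x; exact: ltW.
by apply: measurable_funD => //; exact: measurable_cst.
Qed.

Lemma res_mulE x : H x * res x = 1 - res x.
Proof. by rewrite /res; field; rewrite gt_eqF. Qed.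

Lemma res_itv x : 0 <= res x <= 1.
Proof. by rewrite invr_ge0 ltW //= invf_le1 // lerDl. Qed.

Lemma bounded_res : bounded_mult res.
Proof.
split; first exact: measurable_res.
by exists 1 => x; have /andP[? ?] := res_itv x; rewrite ger0_norm.
Qed.

Lemma bounded_Hres : bounded_mult (fun x => H x * res x).
Proof.
rewrite (_ : (fun _ => _) = (fun x => 1 - res x)).
  by apply: bounded_multB; [exact: bounded_mult_cst|exact: bounded_res].
by apply/funext => x; rewrite res_mulE.
Qed.

(** Multiplication by this function is the product of the square root of
    multiplication by H with the resolvent. *)
Definition sqrtres x := Num.sqrt (H x) * res x.

Lemma sqrtres_sqr x : sqrtres x * sqrtres x = res x * (H x * res x).
Proof. by rewrite /sqrtres -{3}(sqr_sqrtr (H0 x)) expr2; ring. Qed.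

Lemma sqrtres_itv x : 0 <= sqrtres x <= 1.
Proof.
have /andP[r0 r1] := res_itv x.
have s0 : 0 <= sqrtres x by rewrite mulr_ge0 ?sqrtr_ge0.
rewrite s0 /= -(@ler_pXn2r _ 2) ?nnegrE // expr1n expr2 sqrtres_sqr res_mulE.
nra.
Qed.

Lemma bounded_sqrtres : bounded_mult sqrtres.
Proof.
split; first by apply: measurable_funM; [exact: measurable_sqrt|
  exact: measurable_res].
by exists 1 => x; have /andP[? ?] := sqrtres_itv x; rewrite ger0_norm.
Qed.

Lemma res_split u : u = multL2 res u + multL2 (fun x => H x * res x) u.
Proof.
apply: L2_ae_ext; have E1 := multL2E u bounded_res.
have E2 := multL2E u bounded_Hres.
apply: filterS3 (L2_aeD (multL2 res u) (multL2 (fun x => H x * res x) u))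
  E1 E2 => x -> -> ->.
by rewrite -mulrDl -rmorphD res_mulE /= addrC subrK mul1r.
Qed.

Lemma multop_res m u : bounded_mult (fun x => m x * res x) ->
  multop mu m (multL2 res u, multL2 (fun x => m x * res x) u).
Proof.
move=> bm; apply/multopP.
apply: filterS2 (multL2E u bounded_res) (multL2E u bm) => x -> ->.
by rewrite rmorphM mulrA.
Qed.

(** With [r = 1 / (1 + H)], the resolvent of the square, the operator [A r] is
    bounded and positive, and it commutes with r, so its square is
    multiplication by [H * r ^+ 2]; by uniqueness in the bounded case [A r] is
    multiplication by [sqrt H * r]. *)
Lemma positive_root_unique (A : set (L2 mu * L2 mu)) :
    linear_op A -> adjoint (L2dot mu) A = A ->
    (forall f g, A (f, g) -> 0 <= L2dot mu g f) ->
    op_comp A A = multop mu H ->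
  A = multop mu (fun x => Num.sqrt (H x)).
Proof.
move=> linA Aadj Apos AA; have [_ Alin Afun] := linA.
have Asym a b a' b' : A (a, b) -> A (a', b') ->
    L2dot mu b a' = L2dot mu a b'.
  by move=> Aab; rewrite -{1}Aadj => /(_ _ _ Aab).
pose Hr := fun x => H x * res x.
have split u : u = multL2 res u + multL2 Hr u := res_split u.
have ex u : {k | A (multL2 res u, k) /\ A (k, multL2 Hr u)}.
  apply: cid; have : op_comp A A (multL2 res u, multL2 Hr u).
    by rewrite AA; apply: multop_res; exact: bounded_Hres.
  by move=> [k]; exists k.
pose B u := sval (ex u).
have B1 u : A (multL2 res u, B u) by rewrite /B; case: (ex u) => k [].
have B2 u : A (B u, multL2 Hr u) by rewrite /B; case: (ex u) => k [].
have br := bounded_res; have bHr := bounded_Hres; have bs := bounded_sqrtres.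
have Blin a u v : B (a *: u + v) = a *: B u + B v.
  have := Alin a _ _ _ _ (B1 u) (B1 v).
  by rewrite -multL2_linear // => /(Afun _ _ _ (B1 _)).
have Bsym u v : L2dot mu (B u) v = L2dot mu u (B v).
  rewrite [in LHS](split v) [in RHS](split u) linearDr linearDl /=.
  by congr (_ + _); [exact: Asym (B1 u) (B1 v)|
    exact/esym/(Asym _ _ _ _ (B2 u) (B2 v))].
have Bpos u : 0 <= L2dot mu (B u) u.
  rewrite [X in L2dot mu (B u) X](split u) linearDr /= addr_ge0 //.
    exact: Apos (B1 u).
  by rewrite -(Asym _ _ _ _ (B2 u) (B2 u)); exact: Apos (B2 u).
(* The resolvent of [A^2] commutes with A, as it commutes with [A^2]. *)
have Ares f g : A (f, g) -> A (multL2 res f, multL2 res g).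
  move=> Afg; suff <- : B f = multL2 res g by [].
  have : op_comp A A (B f, g - B f).
    exists (multL2 Hr f); split; first exact: B2.
    have -> : multL2 Hr f = f - multL2 res f.
      by rewrite {2}(split f) addrC addKr.
    exact: linear_opB linA Afg (B1 f).
  rewrite AA => /multopP E1; apply: L2_ae_ext.
  apply: filterS3 E1 (L2_aeB g (B f)) (multL2E g br) => x E1 E2 ->.
  rewrite E2 in E1; move/eqP: E1; rewrite subr_eq => /eqP ->.
  rewrite -[X in _ + X]mul1r -mulrDl mulrA -[1](rmorph1 (real_complex R)).
  by rewrite -rmorphD -rmorphM addrC mulVf ?gt_eqF // mul1r.
have Bs : forall u, B u = multL2 sqrtres u.
  apply: bounded_root_unique => // [x|u]; first exact: sqrtres_itv.
  rewrite (Afun _ _ _ (B1 (B u)) (Ares _ _ (B2 u))) multL2_comp //.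
  by congr (multL2 _ u); apply/funext => x; rewrite sqrtres_sqr.
have sub : A `<=` multop mu (fun x => Num.sqrt (H x)).
  move=> [a b] Aab.
  apply: (multop_cancel br bs res_neq0).
  apply: (dot_sep (dot := L2dot mu)) => u.
  by rewrite -!multL2_dot // -Bs; exact: Asym (B1 u) Aab.
apply/seteqP; split=> // -[f g] fg; rewrite -Aadj => a b /= Aab.
exact: multop_sym (sub _ Aab) fg.
Qed.

End UnboundedRoot.

(** * Integrals and scalar products of weighted compositions *)

Section FiniteDensity.
Context {R : realType} {d : measure_display} {X : measurableType d}.
Variable mu : {measure set X -> \bar R}.
Implicit Types (f g u : L2 mu) (m : X -> R) (F G : X -> R[i]).
Variables (phi : X -> X) (w : X -> R[i]) (H : X -> R).
Hypothesis mphi : measurable_fun [set: X] phi.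
Hypothesis mw : cmeasurable w.
Hypothesis mH : measurable_fun [set: X] H.
Hypothesis H0 : forall x, 0 <= H x.
Hypothesis dens : forall A, measurable A ->
  mu_w mu w (phi @^-1` A) = (\int[mu]_(x in A) (H x)%:E)%E.

Let measurable_sqw : measurable_fun setT (fun x => (csqr (w x))%:E).
Proof. by apply/measurable_EFinP; exact: measurable_csqr. Qed.

Let measurable_EH : measurable_fun setT (fun x => (H x)%:E).
Proof. exact/measurable_EFinP. Qed.

Lemma integral_transfer (F : X -> R) : measurable_fun setT F ->
  (\int[mu]_x (F (phi x) * csqr (w x))%:E = \int[mu]_x (F x * H x)%:E)%E.
Proof.
move=> mF; have mEF : measurable_fun setT (fun x => (F x)%:E).
  exact/measurable_EFinP.
have k0 x : (0 <= (csqr (w x))%:E)%E by rewrite lee_fin csqr_ge0.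
have h0 x : (0 <= (H x)%:E)%E by rewrite lee_fin.
rewrite integralE [RHS]integralE; congr (_ - _)%E.
  rewrite (funeposM_real (F \o phi)) => [|x]; last exact: csqr_ge0.
  rewrite funeposM_real //.
  apply: (ge0_integral_density_comp (g := fun x => maxe (F x)%:E 0%E) mphi
    measurable_sqw k0 measurable_EH h0) => //.
    by apply: measurable_maxe => //; exact: measurable_cst.
  by move=> x; rewrite le_max lexx orbT.
rewrite (funenegM_real (F \o phi)) => [|x]; last exact: csqr_ge0.
rewrite funenegM_real //.
apply: (ge0_integral_density_comp (g := fun x => maxe (- F x)%:E 0%E) mphi
  measurable_sqw k0 measurable_EH h0) => //.
  apply: measurable_maxe; last exact: measurable_cst.
  by apply/measurable_EFinP; exact: measurableT_comp.
by move=> x; rewrite le_max lexx orbT.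
Qed.

Lemma cintegral_transfer F : cmeasurable F ->
  cintegral mu (fun x => F (phi x) * (csqr (w x))%:C) =
  cintegral mu (fun x => F x * (H x)%:C).
Proof.
move=> [mF1 mF2]; have ReM (z : R[i]) (a : R) :
    complex.Re (z * a%:C) = complex.Re z * a.
  by case: z => p q /=; rewrite mulr0 subr0.
have ImM (z : R[i]) (a : R) : complex.Im (z * a%:C) = complex.Im z * a.
  by case: z => p q /=; rewrite mulr0 add0r.
rewrite /cintegral /Rintegral; congr (fine _ +i* fine _)%C.
  under eq_integral do rewrite ReM; under [RHS]eq_integral do rewrite ReM.
  exact: integral_transfer mF1.
under eq_integral do rewrite ImM; under [RHS]eq_integral do rewrite ImM.
exact: integral_transfer mF2.
Qed.

Lemma ae_weight_off (N : set X) : measurable N ->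
  (\int[mu]_(x in N) (H x)%:E = 0)%E ->
  {ae mu, forall x, w x = 0 \/ ~ N (phi x)}.
Proof.
move=> mN; rewrite -dens // /mu_w => I0.
have mD : measurable (phi @^-1` N).
  by rewrite -[X in measurable X]setTI; exact: mphi.
have : (\int[mu]_(x in phi @^-1` N) `|(csqr (w x))%:E| = 0)%E.
  by under eq_integral do rewrite gee0_abs ?lee_fin ?csqr_ge0 //.
move/(ae_eq_integral_abs mu mD); rewrite /ae_eq.
have mwN : measurable_fun (phi @^-1` N) (fun x => (csqr (w x))%:E).
  exact: measurable_funTS.
move=> /(_ mwN); apply: filterS => x Nx.
have [xN|] := pselect (N (phi x)); last by right.
by left; apply: csqr_eq0; have [] := Nx xN.
Qed.

Lemma nonsingular_weight : nonsingular mu phi w.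
Proof.
move=> P [N [mN N0 PN]].
have : {ae mu, forall x, w x = 0 \/ ~ N (phi x)}.
  apply: ae_weight_off => //.
  by rewrite (null_set_integral mN) //; exact: measurable_funTS.
apply: filterS => x [->|Nx]; [by left|right].
by apply: contrapT => /PN.
Qed.

(** The mass that the weight gives to the preimage of the zero set of H is the
    integral of H over that set. *)
Lemma ae_weight_density : {ae mu, forall x, w x = 0 \/ H (phi x) != 0}.
Proof.
have mN : measurable (H @^-1` [set 0]).
  by rewrite -[X in measurable X]setTI; exact: mH.
have : {ae mu, forall x, w x = 0 \/ ~ (H @^-1` [set 0]) (phi x)}.
  by apply: ae_weight_off => //; apply: integral0_eq => x /= ->.
by apply: filterS => x [->|/eqP]; [left|right].
Qed.

Lemma integral_csqr_weighted F : cmeasurable F ->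
  (\int[mu]_x (csqr (w x * F (phi x)))%:E =
   \int[mu]_x (csqr ((Num.sqrt (H x))%:C * F x))%:E)%E.
Proof.
move=> mF; transitivity (\int[mu]_x (csqr (F (phi x)) * csqr (w x))%:E)%E.
  by apply: eq_integral => x _; rewrite csqrM mulrC.
rewrite (integral_transfer (measurable_csqr mF)).
by apply: eq_integral => x _; rewrite csqr_realM sqr_sqrtr // mulrC.
Qed.

Lemma dot_weighted p q F G : cmeasurable F -> cmeasurable G ->
  {ae mu, forall x, (p : L2 mu) x = w x * F (phi x)} ->
  {ae mu, forall x, (q : L2 mu) x = w x * G (phi x)} ->
  L2dot mu p q = cintegral mu (fun x => F x * conjC (G x) * (H x)%:C).
Proof.
move=> mF mG pF qG; rewrite -cintegral_transfer; last exact: cmeasurable_mulC.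
apply: dot_ae.
  apply: cmeasurableM.
    by apply: cmeasurable_mulC; apply: cmeasurable_comp.
  by apply: cmeasurable_real; exact: measurable_csqr.
apply: filterS2 pF qG => x -> ->.
by rewrite (rmorphM conjC) /= csqrE; ring.
Qed.

Lemma square_integrable_weighted F : cmeasurable F ->
  square_integrable mu (fun x => w x * F (phi x)) <->
  square_integrable mu (fun x => (Num.sqrt (H x))%:C * F x).
Proof.
move=> mF; split=> -[_ LF]; split.
- by apply: cmeasurable_realM => //; exact: measurable_sqrt.
- by rewrite -integral_csqr_weighted.
- by apply: cmeasurableM => //; exact: cmeasurable_comp.
- by rewrite integral_csqr_weighted.
Qed.

(** * The modulus *)

Let T := wco mu phi w.
Let sqrtH x := Num.sqrt (H x).

Let msqrtH : measurable_fun setT sqrtH.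
Proof. exact: measurable_sqrt. Qed.

Let cmeasurable_L2 u : cmeasurable u := L2_cmeasurable u.

Lemma wco_ex f : square_integrable mu (fun x => (sqrtH x)%:C * f x) ->
  exists g, T (f, g).
Proof.
move=> /(square_integrable_weighted (cmeasurable_L2 f)) Lf.
by exists (toL2 mu (fun x => w x * f (phi x))); exact/wcoP/toL2E.
Qed.

Lemma wco_dot f g f' g' : T (f, g) -> T (f', g') ->
  L2dot mu g g' = cintegral mu (fun x => f x * conjC (f' x) * (H x)%:C).
Proof. by move=> /wcoP E1 /wcoP E2; exact: dot_weighted E1 E2. Qed.

Lemma csqr_sqrtH_le x (z : R[i]) :
  csqr ((sqrtH x)%:C * z) <= 1 * csqr z + 1 * csqr ((H x)%:C * z).
Proof.
rewrite !csqr_realM sqr_sqrtr // !mul1r -[X in X + _]mul1r -mulrDl.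
by rewrite ler_wpM2r ?csqr_ge0 //; nra.
Qed.

Lemma multop_sqrt_ex f g : multop mu H (f, g) ->
  square_integrable mu (fun x => (sqrtH x)%:C * f x).
Proof.
move=> /multopP fg.
have mf : cmeasurable (fun x => (sqrtH x)%:C * f x).
  by apply: cmeasurable_realM.
have Lg : square_integrable mu (fun x => (H x)%:C * f x).
  apply: square_integrable_ae (L2_square_integrable g) _.
    exact: cmeasurable_realM.
  by apply: filterS fg => x ->.
exact: (square_integrable_le mf (L2_square_integrable f) Lg
  (fun x => csqr_sqrtH_le x (f x))).
Qed.

(** The polarized form of [|T f|^2 = int H |f|^2], tested on the functions
    [u / (1 + H)]. *)
Lemma adjoint_wco_wco : op_comp (adjoint (L2dot mu) T) T = multop mu H.
Proof.
have br := bounded_res mH H0; have bHr := bounded_Hres mH H0.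
apply/seteqP; split=> -[f g].
  move=> [k [/= Tfk Tkg]]; apply: (multop_cancel br bHr (res_neq0 H0)).
  apply: (dot_sep (dot := L2dot mu)) => u.
  have [b Tub] : exists b, T (multL2 (res H) u, b).
    apply: (wco_ex); apply: (@multop_sqrt_ex _ _); exact: multop_res.
  rewrite -!multL2_dot // -(Tkg _ _ Tub) (wco_dot Tub Tfk).
  apply: dot_ae.
    apply: cmeasurableM; last exact: cmeasurable_real.
    exact: cmeasurable_mulC.
  apply: filterS2 (multL2E u br) (multL2E u bHr) => x -> ->.
  by rewrite rmorphM /=; ring.
move=> fg; have [k Tfk] := wco_ex (multop_sqrt_ex fg).
exists k; split=> // a b Tab /=; rewrite (wco_dot Tab Tfk); apply/esym.
move/multopP in fg; apply: dot_ae.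
  apply: cmeasurableM; last exact: cmeasurable_real.
  exact: cmeasurable_mulC.
apply: filterS fg => x ->; rewrite (rmorphM conjC) /= conjC_real; ring.
Qed.

(** As [0^-1 = 0], these sets exhaust X, the zeros of H included; on each of
    them both H and [1 / H] are bounded. *)
Definition trunc_set n : set X := [set x | H x <= n%:R /\ (H x)^-1 <= n%:R].

Definition trunc n : X -> R := \1_(trunc_set n).

Lemma measurable_trunc n : measurable_fun setT (trunc n).
Proof.
apply: measurable_indic.
have -> : trunc_set n = (H @^-1` [set` `]-oo, n%:R]]) `&`
    ((fun x => (H x)^-1) @^-1` [set` `]-oo, n%:R]]).
  by apply/seteqP; split=> x /=; rewrite !in_itv.
apply: measurableI; rewrite -[X in measurable X]setTI.
  exact: mH.
exact: measurable_inv.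
Qed.

Lemma trunc_itv n x : 0 <= trunc n x <= 1.
Proof. by rewrite /trunc indicE; case: (_ \in _); rewrite /= ?lexx ler01. Qed.

Lemma trunc_sqr n x : trunc n x * trunc n x = trunc n x.
Proof. by rewrite /trunc indicE; case: (_ \in _); rewrite /= ?mulr1 ?mulr0. Qed.

Lemma trunc_near x : \forall n \near \oo, trunc n x = 1.
Proof.
near=> n; rewrite /trunc indicE mem_set //; split.
  near: n; exact: nbhs_infty_ger.
near: n; exact: nbhs_infty_ger.
Unshelve. all: by end_near. Qed.

Lemma bounded_trunc n : bounded_mult (trunc n).
Proof.
split; first exact: measurable_trunc.
by exists 1 => x; have /andP[? ?] := trunc_itv n x; rewrite ger0_norm.
Qed.

Lemma bounded_mul_trunc m n : measurable_fun setT m ->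
  (forall x, 0 <= m x <= 1 + H x + (H x)^-1) ->
  bounded_mult (fun x => m x * trunc n x).
Proof.
move=> mm mle; split.
  by apply: measurable_funM => //; exact: measurable_trunc.
exists (1 + n%:R + n%:R) => x; have /andP[m0 mx] := mle x.
have n0 : (0 : R) <= n%:R by [].
rewrite normrM (ger0_norm m0) /trunc indicE.
case: (boolP (x \in trunc_set n)) => [|_] /=; last by rewrite normr0 mulr0; lra.
by rewrite inE normr1 mulr1 => -[? ?]; lra.
Qed.

Lemma trunc_approx u (e : R) : 0 < e ->
  exists n, sqnorm (u - multL2 (trunc n) u) < e.
Proof.
by apply: truncation_approx;
  [exact: measurable_trunc|exact: trunc_itv|exact: trunc_near].
Qed.

Lemma sqrtH_le x : 0 <= sqrtH x <= 1 + H x + (H x)^-1.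
Proof.
rewrite sqrtr_ge0 /= ler_wpDr ?invr_ge0 //.
have := sqr_sqrtr (H0 x); have : 0 <= Num.sqrt (H x) by [].
rewrite /sqrtH; set a := Num.sqrt _ => a0 <-; nra.
Qed.

Lemma hdense_sqrt : hdense (L2dot mu) (op_dom (multop mu sqrtH)).
Proof.
apply/seteqP; split=> // f _; apply/hclosureP => e e0.
have [n fn] := trunc_approx f e0; exists (multL2 (trunc n) f) => //.
have bt := bounded_mul_trunc n msqrtH sqrtH_le.
exists (multL2 (fun x => sqrtH x * trunc n x) f); apply/multopP.
apply: filterS2 (multL2E f bt) (multL2E f (bounded_trunc n)) => x -> ->.
by rewrite rmorphM mulrA.
Qed.

Lemma hdense_wco : hdense (L2dot mu) (op_dom T).
Proof.
apply/seteqP; split=> // f _; apply/hclosureP => e e0.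
have [n fn] := trunc_approx f e0; exists (multL2 (trunc n) f) => //.
have bt := bounded_mul_trunc n msqrtH sqrtH_le.
apply: wco_ex; apply: square_integrable_ae
  (L2_square_integrable (multL2 (fun x => sqrtH x * trunc n x) f)) _.
  exact: cmeasurable_realM.
apply: filterS2 (multL2E f bt) (multL2E f (bounded_trunc n)) => x -> ->.
by rewrite rmorphM mulrA.
Qed.

(** The scalar product is the squared norm of the product of f with the fourth
    root of H. *)
Lemma multop_sqrt_ge0 f g : multop mu sqrtH (f, g) -> 0 <= L2dot mu g f.
Proof.
move=> /multopP fg; pose q x := Num.sqrt (sqrtH x).
have mq : measurable_fun setT q by exact: measurable_sqrt.
have mqf : cmeasurable (fun x => (q x)%:C * f x) by exact: cmeasurable_realM.
have Lg : square_integrable mu (fun x => (sqrtH x)%:C * f x).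
  apply: square_integrable_ae (L2_square_integrable g) _.
    exact: cmeasurable_realM.
  by apply: filterS fg => x ->.
have Lq : square_integrable mu (fun x => (q x)%:C * f x).
  apply: (square_integrable_le (a := 1) (b := 1) mqf
    (L2_square_integrable f) Lg) => x.
  rewrite !csqr_realM sqr_sqrtr ?sqrtr_ge0 // !mul1r -[X in X + _]mul1r -mulrDl.
  by rewrite ler_wpM2r ?csqr_ge0 //; nra.
have Eq := toL2E Lq; set k := toL2 _ _ in Eq.
rewrite (_ : L2dot mu g f = L2dot mu k k) ?dnorm_ge0 //.
apply: eq_dot; apply: filterS2 fg Eq => x -> ->.
rewrite -[sqrtH x](sqr_sqrtr (sqrtr_ge0 _)) -/(q x).
by rewrite (rmorphM conjC) /= conjC_real rmorphXn /=; ring.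
Qed.

(** Multiplication by [sqrt H] is a positive selfadjoint square root of
    [T^* T = M_H], and such a root is unique. *)
Lemma abs_op_wco : abs_op (L2dot mu) T = multop mu sqrtH.
Proof.
have br := bounded_res mH H0; have bs := bounded_sqrtres mH H0.
have lin : linear_op (multop mu sqrtH).
  by apply: wco_linear; exact: nonsingular_id.
have adj : adjoint (L2dot mu) (multop mu sqrtH) = multop mu sqrtH.
  apply: (@multop_adjoint _ _ _ _ sqrtH (res H)) => //; exact: res_neq0.
rewrite /abs_op; apply: xget_unique => [|A [linA [_ adjA] posA AA]]; last first.
  by apply: positive_root_unique => //; rewrite AA adjoint_wco_wco.
split => //; [by split=> //; exact: hdense_sqrt|exact: multop_sqrt_ge0|].
rewrite adjoint_wco_wco; apply/seteqP; split=> -[f g].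
  move=> [k [/= /multopP fk /multopP kg]]; apply/multopP.
  apply: filterS2 fk kg => x -> ->.
  by rewrite mulrA -rmorphM -expr2 sqr_sqrtr.
move=> fg; have [k fk] := multop_ex (multop_sqrt_ex fg).
exists k; split=> //; move/multopP in fk; move/multopP in fg.
apply/multopP; apply: filterS2 fg fk => x -> ->.
by rewrite mulrA -rmorphM -expr2 sqr_sqrtr.
Qed.

(** * The polar decomposition *)

Let invH x := (H x)^-1.
Let invsqrtH x := (sqrtH x)^-1.
Definition pos_ind x : R := (H x != 0)%:R.

Let minvH : measurable_fun setT invH.
Proof. exact: measurable_inv. Qed.

Let minvsqrtH : measurable_fun setT invsqrtH.
Proof. by apply: measurable_inv => // x; exact: sqrtr_ge0. Qed.

Let sqrtH_eq0 x : (sqrtH x == 0) = (H x == 0).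
Proof. by rewrite sqrtr_eq0 eq_le H0 andbT. Qed.

Let sqrtH_sqr x : H x = sqrtH x * sqrtH x.
Proof. by rewrite -expr2 sqr_sqrtr. Qed.

Let sqrt_invsqrt x : sqrtH x * invsqrtH x = pos_ind x.
Proof.
rewrite /pos_ind -sqrtH_eq0 /invsqrtH; have [->|s0] := eqVneq (sqrtH x) 0.
  by rewrite mul0r.
by rewrite divff.
Qed.

Let sqrt_inv x : sqrtH x * invH x = invsqrtH x.
Proof.
rewrite /invH sqrtH_sqr /invsqrtH; have [->|s0] := eqVneq (sqrtH x) 0.
  by rewrite mul0r invr0.
by rewrite invfM mulrA divff // mul1r.
Qed.

Let H_inv x : H x * invH x = pos_ind x.
Proof. by rewrite {1}sqrtH_sqr -mulrA sqrt_inv sqrt_invsqrt. Qed.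

Let pos_sqr x : pos_ind x * pos_ind x = pos_ind x.
Proof. by rewrite /pos_ind; case: (_ != _); rewrite ?mulr1 ?mulr0. Qed.

Let bounded_pos : bounded_mult pos_ind.
Proof.
split.
  rewrite (_ : pos_ind = fun x => H x * invH x); first exact: measurable_funM.
  by apply/funext => x; rewrite H_inv.
by exists 1 => x; rewrite /pos_ind; case: (_ != _); rewrite ?normr1 ?normr0.
Qed.

Let bounded_invsqrt_trunc n : bounded_mult (fun x => invsqrtH x * trunc n x).
Proof.
apply: bounded_mul_trunc => // x; rewrite invr_ge0 sqrtr_ge0 /=.
have := H0 x; have : 0 <= invsqrtH x by rewrite invr_ge0 sqrtr_ge0.
rewrite (_ : (H x)^-1 = invsqrtH x * invsqrtH x); first by nra.
by rewrite -invfM -sqrtH_sqr.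
Qed.

Definition weight m x : R[i] := w x * (m (phi x))%:C.

Lemma weight1 : weight (fun=> 1) = w.
Proof. by apply/funext => x; rewrite /weight mulr1. Qed.

Lemma weighted_wcoP m f g : wco mu phi (weight m) (f, g) <->
  {ae mu, forall x, g x = w x * ((m (phi x))%:C * f (phi x))}.
Proof.
rewrite wcoP; split; apply: filterS => x ->; by rewrite /weight mulrA.
Qed.

Lemma nonsingular_weighted m : nonsingular mu phi (weight m).
Proof.
move=> P /nonsingular_weight; apply: filterS => x [wx|]; last by right.
by left; rewrite /weight wx mul0r.
Qed.

Lemma linear_weighted m : linear_op (wco mu phi (weight m)).
Proof. exact/wco_linear/nonsingular_weighted. Qed.

(** Both squared norms are the integral of [H * |m f|^2]. Together with
    [weighted_ex] this reduces domains, norms and kernels of weighted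
    compositions to those of multiplication operators. *)
Lemma weighted_norm m f g : measurable_fun setT m ->
  wco mu phi (weight m) (f, g) -> exists2 k,
    multop mu (fun x => sqrtH x * m x) (f, k) & sqnorm g = sqnorm k.
Proof.
move=> mm /weighted_wcoP fg; have mmf := cmeasurable_realM mm (cmeasurable_L2 f).
have Lg : square_integrable mu (fun x => w x * ((m (phi x))%:C * f (phi x))).
  apply: square_integrable_ae (L2_square_integrable g) _.
    by apply: cmeasurableM => //; exact: cmeasurable_comp mmf.
  by apply: filterS fg => x ->.
have Lk := (square_integrable_weighted mmf).1 Lg.
have [|k fk] := @multop_ex _ _ _ mu (fun x => sqrtH x * m x) f.
  apply: square_integrable_ae Lk _; last first.
    by apply: nearW => x; rewrite rmorphM mulrA.
  by apply: cmeasurable_realM => //; exact: measurable_funM.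
exists k => //; apply: EFin_inj.
have {fk} kE : {ae mu, forall x, k x = (sqrtH x)%:C * ((m x)%:C * f x)}.
  by move/multopP: fk; apply: filterS => x ->; rewrite rmorphM mulrA.
rewrite (sqnorm_ae Lg.1 fg) (integral_csqr_weighted mmf) -(sqnorm_ae _ kE) //.
by case: Lk.
Qed.

Lemma weighted_ex m f k : measurable_fun setT m ->
  multop mu (fun x => sqrtH x * m x) (f, k) ->
  exists g, wco mu phi (weight m) (f, g).
Proof.
move=> mm /multopP fk; have mmf := cmeasurable_realM mm (cmeasurable_L2 f).
have Lk : square_integrable mu (fun x => (sqrtH x)%:C * ((m x)%:C * f x)).
  apply: square_integrable_ae (L2_square_integrable k) _.
    by apply: cmeasurable_realM.
  by apply: filterS fk => x ->; rewrite rmorphM mulrA.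
have /toL2E E := (square_integrable_weighted mmf).2 Lk.
by exists (toL2 mu (fun x => w x * ((m (phi x))%:C * f (phi x))));
  exact/weighted_wcoP.
Qed.

(** This is both the kernel of T and the orthogonal complement of the range of
    its adjoint; it is encoded as the kernel of the projection given by
    [pos_ind]. *)
Definition kerH : set (L2 mu) := [set f | multL2 pos_ind f = 0].

(** By [weighted_norm], the image of f vanishes if and only if [sqrt H * m * f]
    does. *)
Lemma ker_weighted m : measurable_fun setT m ->
  (forall x, H x != 0 -> m x != 0) -> op_ker (wco mu phi (weight m)) = kerH.
Proof.
move=> mm m0; apply/seteqP; split=> f; rewrite /op_ker /kerH /=.
  move=> /(weighted_norm mm) [k /multopP fk]; rewrite sqnorm0 => /esym.
  move=> /sqnorm_eq0 k0; rewrite k0 in fk; apply: L2_ae_ext.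
  apply: filterS3 fk (L2_ae0 mu) (multL2E f bounded_pos) => x E1 E2 ->.
  rewrite E2 /pos_ind; have [_|Hx] := eqVneq (H x) 0; first by rewrite mul0r.
  move/eqP: (etrans (esym E1) E2); rewrite mulf_eq0 fmorph_eq0 mulf_eq0 sqrtH_eq0.
  by rewrite (negbTE Hx) (negbTE (m0 _ Hx)) /= => /eqP ->; rewrite mulr0.
move=> f0; have E := multL2E f bounded_pos; rewrite f0 in E.
have {}E : {ae mu, forall x, H x != 0 -> (f : L2 mu) x = 0}.
  apply: filterS2 E (L2_ae0 mu) => x -> + Hx.
  by rewrite /pos_ind Hx mul1r.
apply/weighted_wcoP; apply: filterS3 (L2_ae0 mu) (nonsingular_weight E)
  ae_weight_density => x -> [->|Hf] [|Hx]; rewrite ?mul0r //.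
  by move=> ->; rewrite mul0r.
by rewrite Hf // !mulr0.
Qed.

Lemma ker_wco : op_ker T = kerH.
Proof.
rewrite /T -weight1; apply: ker_weighted; first exact: measurable_cst.
by move=> x _; exact: oner_neq0.
Qed.

Lemma pos_idem u : multL2 pos_ind (multL2 pos_ind u) = multL2 pos_ind u.
Proof.
rewrite (multL2_comp _ bounded_pos bounded_pos); congr (multL2 _ u).
exact/funext/pos_sqr.
Qed.

Lemma kerH_subpos f : kerH (f - multL2 pos_ind f).
Proof. by rewrite /kerH /= (multL2B _ _ bounded_pos) pos_idem subrr. Qed.

Lemma horth_kerH f : horth (L2dot mu) kerH f <-> multL2 pos_ind f = f.
Proof.
split=> [ff|<- k k0]; last by rewrite (multL2_dot _ _ bounded_pos) k0 linear0r.
have z0 := kerH_subpos f; set z := _ - _ in z0.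
apply/esym/eqP; rewrite -subr_eq0 -/z -(dnorm_eq0 (L2dot mu)) {1}/z.
rewrite linearBl /= (multL2_dot _ _ bounded_pos) (ff _ z0) sub0r.
by rewrite (_ : multL2 pos_ind z = 0) // linear0r oppr0.
Qed.

Let polar_factor := wco mu phi (weight invsqrtH).

Lemma polar_factor_total f : exists g, polar_factor (f, g).
Proof.
apply: (@weighted_ex _ _ (multL2 pos_ind f)) => //; apply/multopP.
apply: filterS (multL2E f bounded_pos) => x ->.
by rewrite sqrt_invsqrt.
Qed.

Lemma polar_factor_norm f g : polar_factor (f, g) ->
  sqnorm g = sqnorm (multL2 pos_ind f).
Proof.
move=> /(weighted_norm minvsqrtH)[k /multopP fk ->]; congr sqnorm.
apply: L2_ae_ext; apply: filterS2 fk (multL2E f bounded_pos) => x -> ->.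
by rewrite sqrt_invsqrt.
Qed.

Lemma wco_polar : T = op_comp polar_factor (multop mu sqrtH).
Proof.
have nsH k f : multop mu sqrtH (f, k) -> {ae mu, forall x,
    w x * ((invsqrtH (phi x))%:C * k (phi x)) = w x * f (phi x)}.
  move=> /multopP /nonsingular_weight fk.
  apply: filterS2 fk ae_weight_density => x [->|->] [|Hx]; rewrite ?mul0r //.
    by move=> ->; rewrite !mul0r.
  by rewrite [_ * (_ * f _)]mulrA -rmorphM mulVf ?sqrtH_eq0 // rmorph1 mul1r.
apply/seteqP; split=> -[f g].
  rewrite {1}/T -weight1 => Tfg.
  have [k fk _] := weighted_norm (measurable_cst _) Tfg.
  have {}fk : multop mu sqrtH (f, k).
    by move/multopP: fk => fk; apply/multopP; apply: filterS fk => x ->;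
      rewrite mulr1.
  exists k; split=> //; apply/weighted_wcoP; move: Tfg; rewrite weight1.
  by move/wcoP; apply: filterS2 (nsH _ _ fk) => x -> ->.
move=> [k [/= /nsH fk /weighted_wcoP kg]]; apply/wcoP.
by apply: filterS2 fk kg => x <- ->.
Qed.

Lemma polar_factor_unitary : is_unitary_part (L2dot mu) T polar_factor.
Proof.
have kerU : op_ker polar_factor = kerH.
  apply: ker_weighted => // x Hx.
  by rewrite invr_eq0 sqrtH_eq0.
split; [|by rewrite ker_wco|by rewrite abs_op_wco wco_polar].
split; first exact: linear_weighted.
- by apply/seteqP; split=> // f _; exact: polar_factor_total.
- exists 1 => f g /polar_factor_norm gf; rewrite mul1r /hnorm !dot_sqnorm gf.
  rewrite ler_sqrtC ?nnegrE ?lecR ?sqnorm_ge0 // -[leRHS]mul1r.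
  rewrite -[X in X * _](expr1n _ 2); apply: sqnorm_multL2_le bounded_pos.1 _.
  by move=> x; rewrite /pos_ind; case: (_ != _); rewrite ?normr1 ?normr0.
move=> f g; rewrite kerU => /horth_kerH fpos /polar_factor_norm; rewrite fpos.
exact: hnorm_eq.
Qed.

(** On the truncations of a function f the polar decomposition prescribes the
    value p of the isometric factor, whose distance to the value at f is then
    that of the arguments. *)
Lemma unitary_part_near f n : exists p, forall V g,
  is_unitary_part (L2dot mu) T V -> V (f, g) ->
  sqnorm (g - p) = sqnorm (multL2 pos_ind f -
                           multL2 (trunc n) (multL2 pos_ind f)).
Proof.
have bt := bounded_trunc n; have brt := bounded_invsqrt_trunc n.
set k := multL2 (fun x => invsqrtH x * trunc n x) f.
set fn := multL2 (trunc n) (multL2 pos_ind f).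
have kfn : multop mu sqrtH (k, fn).
  have E1 := multL2E f brt; have E2 := multL2E f bounded_pos.
  apply/multopP; apply: filterS3 E1 E2 (multL2E (multL2 pos_ind f) bt) => x.
  move=> kE posE fnE; rewrite /fn fnE posE /k kE [RHS]mulrA [LHS]mulrA.
  rewrite -(rmorphM (real_complex R) (sqrtH x)) mulrA sqrt_invsqrt.
  by rewrite (rmorphM (real_complex R)) /= [in RHS](mulrC (pos_ind x)%:C).
have [p Tkp] : exists p, T (k, p).
  rewrite /T -weight1; apply: (@weighted_ex _ _ fn).
    exact: measurable_cst.
  by apply/multopP; move/multopP: kfn; apply: filterS => x ->; rewrite mulr1.
exists p => V g [[linV _ _ isoV]]; rewrite ker_wco abs_op_wco => kerV TV Vfg.
have [q [/= kq Vqp]] : op_comp V (multop mu sqrtH) (k, p) by rewrite -TV.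
have {kq} qfn : q = fn.
  apply: L2_ae_ext; move/multopP: kq; move/multopP: kfn.
  by apply: filterS2 => x -> ->.
rewrite qfn in Vqp; have V1 := linear_opB linV Vfg Vqp.
have V0 : V (f - multL2 pos_ind f, 0).
  by rewrite -[V _]/(op_ker V (f - multL2 pos_ind f)) kerV; exact: kerH_subpos.
have := linear_opB linV V1 V0; rewrite subr0.
rewrite (_ : _ - _ - _ = multL2 pos_ind f - fn); last first.
  by rewrite opprB addrC addrA subrK.
move=> /isoV iso; apply/hnorm_sqnorm/iso; rewrite kerV; apply/horth_kerH.
have fnpos : multL2 pos_ind fn = fn.
  rewrite /fn (multL2_comm (multL2 pos_ind f) bounded_pos bt).
  by congr (multL2 _ _); exact: pos_idem.
by rewrite (multL2B (multL2 pos_ind f) fn bounded_pos) (pos_idem f) fnpos.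
Qed.

(** By [unitary_part_near], the distance between the values of two isometric
    factors is controlled by the error of a truncation. *)
Lemma unitary_part_wco : unitary_part (L2dot mu) T = polar_factor.
Proof.
suff sub V V' : is_unitary_part (L2dot mu) T V ->
    is_unitary_part (L2dot mu) T V' -> V `<=` V'.
  apply: xget_unique; first exact: polar_factor_unitary.
  by move=> V uV; apply/seteqP; split; apply: sub => //;
    exact: polar_factor_unitary.
move=> uV uV' [f g] Vfg; have [[_ domV' _ _] _ _] := uV'.
have [g' Vfg'] : op_dom V' f by rewrite domV'.
suff -> : g = g' by [].
apply/eqP; rewrite -subr_eq0; apply/eqP/sqnorm_eq0/eqP.
rewrite eq_le sqnorm_ge0 andbT leNgt; apply/negP => e0.
have [|n fn] := @trunc_approx (multL2 pos_ind f) (sqnorm (g - g') / 4).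
  by rewrite divr_gt0.
have [p np] := unitary_part_near f n.
have := sqnormB_le (g - p) (g' - p).
rewrite (np _ _ uV Vfg) (np _ _ uV' Vfg') opprB addrA subrK => le.
by move: fn; rewrite ltr_pdivlMr // => /lt_le_trans /(_ le); lra.
Qed.

(** * The reciprocal of the adjoint *)

Let recip := wco mu phi (weight invH).

Let pos_inv x : pos_ind x * invH x = invH x.
Proof.
by rewrite /pos_ind /invH; have [->|_] := eqVneq (H x) 0;
  rewrite ?mul1r // invr0 mulr0.
Qed.

Let bounded_inv_trunc n : bounded_mult (fun x => invH x * trunc n x).
Proof.
apply: bounded_mul_trunc => // x.
by rewrite invr_ge0 H0 /= lerDr addr_ge0.
Qed.

Lemma reciprocal_dom f :
  op_dom recip f <-> exists k, multop mu invsqrtH (f, k).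
Proof.
have E : (fun x => sqrtH x * invH x) = invsqrtH by exact/funext/sqrt_inv.
split=> [[g /(weighted_norm minvH)[k fk _]]|[k fk]].
  by exists k; rewrite -E.
by apply: (@weighted_ex _ _ k) => //; rewrite E.
Qed.

(** Composing with the adjoint restricts f to the set where H does not vanish,
    because [1 / H * H] is the indicator function of that set. *)
Lemma adjoint_reciprocal f g : recip (f, g) ->
  adjoint (L2dot mu) T (g, multL2 pos_ind f).
Proof.
move=> /weighted_wcoP fg a b /wcoP Tab /=.
have mf : cmeasurable (fun x => (invH x)%:C * f x) by exact: cmeasurable_realM.
rewrite (dot_weighted (cmeasurable_L2 a) mf Tab fg); apply/esym/dot_ae.
  apply: cmeasurableM; last exact: cmeasurable_real.
  exact: cmeasurable_mulC.
apply: filterS (multL2E f bounded_pos) => x ->.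
rewrite !(rmorphM conjC) /= !conjC_real -H_inv rmorphM /=; ring.
Qed.

(** The range of [T^* T = M_H] already suffices to see that a function
    orthogonal to the range of the adjoint vanishes where H does not. *)
Lemma horth_ran_adjoint :
  horth (L2dot mu) (op_ran (adjoint (L2dot mu) T)) = kerH.
Proof.
have bHr := bounded_Hres mH H0.
apply/seteqP; split=> f.
  move=> fran; have fH : multL2 (fun x => H x * res H x) f = 0.
    apply: (dot_sep (dot := L2dot mu)) => u; rewrite linear0r -multL2_dot //.
    apply/dot_eq0C/fran.
    have : op_comp (adjoint (L2dot mu) T) T
        (multL2 (res H) u, multL2 (fun x => H x * res H x) u).
      by rewrite adjoint_wco_wco; exact: multop_res.
    by move=> [k [_ ?]]; exists k.
  have E1 := multL2E f bHr; rewrite fH in E1.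
  apply: L2_ae_ext.
  apply: filterS3 E1 (L2_ae0 mu) (multL2E f bounded_pos) => x E1 E2 ->.
  rewrite E2 /pos_ind; have [_|Hx] := eqVneq (H x) 0; first by rewrite mul0r.
  move/eqP: (etrans (esym E1) E2); rewrite mulf_eq0 fmorph_eq0 mulf_eq0.
  by rewrite (negbTE Hx) (negbTE (res_neq0 H0 x)) /= => /eqP ->; rewrite mulr0.
rewrite -ker_wco => Tf g [p /(_ _ _ Tf)] /= <-.
by rewrite linear0l.
Qed.

Lemma adjoint_pos f g : adjoint (L2dot mu) T (g, f) -> multL2 pos_ind f = f.
Proof.
move=> Tgf; apply/horth_kerH => k; rewrite -horth_ran_adjoint => kran.
by apply: dot_eq0C; apply: kran; exists g.
Qed.

(** Testing [g] against [C_(phi,w) k], where [k] is [f / H] truncated, the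
    nonnegative quantity [|C_(phi,w) k - g|^2] simplifies to the difference
    between [|g|^2] and the integral of [|f|^2 / H] over the truncation set. *)
Lemma adjoint_trunc_le f g n : adjoint (L2dot mu) T (g, f) ->
  sqnorm (multL2 (fun x => invsqrtH x * trunc n x) f) <= sqnorm g.
Proof.
move=> Tgf; have bi := bounded_inv_trunc n; have bs := bounded_invsqrt_trunc n.
set k := multL2 (fun x => invH x * trunc n x) f.
set z := multL2 _ f.
have kz : multop mu (fun x => sqrtH x * 1) (k, z).
  apply/multopP; apply: filterS2 (multL2E f bi) (multL2E f bs) => x kE zE.
  by rewrite /k kE /z zE mulrA -(rmorphM (real_complex R)) mulr1 mulrA sqrt_inv.
have [p Tkp] : exists p, T (k, p).
  by rewrite /T -weight1; exact: weighted_ex (measurable_cst _) kz.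
have pz : L2dot mu p p = L2dot mu z z.
  rewrite (wco_dot Tkp Tkp); apply/esym/dot_ae.
    apply: cmeasurableM; last exact: cmeasurable_real.
    exact: cmeasurable_mulC.
  move/multopP: kz; apply: filterS => x ->.
  rewrite (rmorphM conjC) /= conjC_real mulr1 [in RHS]sqrtH_sqr rmorphM /=.
  by ring.
have kf : L2dot mu k f = L2dot mu z z.
  apply: eq_dot; apply: filterS2 (multL2E f bi) (multL2E f bs) => x kE zE.
  rewrite /k kE /z zE (rmorphM conjC) /= conjC_real -sqrt_inv.
  rewrite -mulrA [RHS]mulrACA -(rmorphM (real_complex R)); congr (_%:C * _).
  rewrite mulrACA trunc_sqr; congr (_ * _).
  by rewrite mulrACA -sqrtH_sqr mulrA H_inv pos_inv.
have pg : L2dot mu p g = L2dot mu z z by rewrite -kf; exact: Tgf Tkp.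
have gp : L2dot mu g p = L2dot mu z z by rewrite dotC pg -dotC.
have := dnorm_ge0 (L2dot mu) (p - g).
rewrite linearBl /= !linearBr /= pz pg gp subrr sub0r opprB.
by rewrite !dot_sqnorm subr_ge0 lecR.
Qed.

Lemma trunc_nondecreasing (n k : nat) x : (n <= k)%N -> trunc n x <= trunc k x.
Proof.
move=> nk; rewrite /trunc !indicE; have [/set_mem [Hn iHn]|_] := boolP (x \in _).
  by rewrite mem_set //; split; rewrite (le_trans _ (_ : n%:R <= k%:R)) ?ler_nat.
by rewrite ler0n.
Qed.

(** The bounds of [adjoint_trunc_le] pass to [f / sqrt H] by monotone
    convergence. *)
Lemma adjoint_reciprocal_dom f g : adjoint (L2dot mu) T (g, f) -> op_dom recip f.
Proof.
move=> Tgf; apply/reciprocal_dom; apply: multop_ex; split.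
  exact: cmeasurable_realM.
pose F n x := (csqr ((invsqrtH x * trunc n x)%:C * f x))%:E.
have FE n x : F n x = (csqr ((invsqrtH x)%:C * f x) * trunc n x)%:E.
  by rewrite /F !csqr_realM exprMn [trunc n x ^+ 2]expr2 trunc_sqr mulrAC.
have mF n : cmeasurable (fun x => (invsqrtH x * trunc n x)%:C * f x).
  by apply: cmeasurable_realM => //; case: (bounded_invsqrt_trunc n).
rewrite (_ : (\int[mu]_x _)%E = limn (fun n => \int[mu]_x F n x)%E).
  apply: (@le_lt_trans _ _ (sqnorm g)%:E); last exact: ltry.
  apply: lime_le.
    apply: ereal_nondecreasing_is_cvgn => n m nm.
    apply: ge0_le_integral => //.
    - by move=> x _; rewrite lee_fin csqr_ge0.
    - by apply/measurable_EFinP; exact: measurable_csqr.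
    - by apply/measurable_EFinP; exact: measurable_csqr.
    - by move=> x _; rewrite !FE lee_fin ler_wpM2l ?csqr_ge0 ?trunc_nondecreasing.
  apply: nearW => n.
  rewrite -(sqnorm_ae _ (multL2E f (bounded_invsqrt_trunc n))) //.
  by rewrite lee_fin adjoint_trunc_le.
rewrite -monotone_convergence //.
- apply: eq_integral => x _; apply/esym/cvg_lim => //; apply: cvg_near_cst.
  by apply: filterS (trunc_near x) => n tn; rewrite FE tn mulr1.
- by move=> n; apply/measurable_EFinP; exact: measurable_csqr.
- by move=> n x _; rewrite lee_fin csqr_ge0.
move=> x _ n m nm; rewrite !FE lee_fin.
by rewrite ler_wpM2l ?csqr_ge0 ?trunc_nondecreasing.
Qed.

(** The truncations of f restricted to the set where H does not vanish are
    images under [T^* T] of truncations of [f / H]. *)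
Lemma hclosure_ran_adjoint f :
  hclosure (L2dot mu) (op_ran (adjoint (L2dot mu) T)) (multL2 pos_ind f).
Proof.
apply/hclosureP => e e0; have [n fn] := trunc_approx (multL2 pos_ind f) e0.
exists (multL2 (trunc n) (multL2 pos_ind f)) => //.
have bi := bounded_inv_trunc n; have bt := bounded_trunc n.
have : multop mu H (multL2 (fun x => invH x * trunc n x) f,
                    multL2 (trunc n) (multL2 pos_ind f)).
  apply/multopP; apply: filterS3 (multL2E f bi) (multL2E f bounded_pos)
    (multL2E (multL2 pos_ind f) bt) => x -> E1 ->.
  rewrite E1 [LHS]mulrA [RHS]mulrA -!(rmorphM (real_complex R)).
  by rewrite [H x * _]mulrA H_inv [trunc n x * _]mulrC.
by rewrite -adjoint_wco_wco => -[k [_ /= ?]]; exists k.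
Qed.

Lemma hdense_reciprocal : hdense (L2dot mu) (op_dom recip).
Proof.
apply/seteqP; split=> // f _; apply/hclosureP => e e0.
have [n fn] := trunc_approx f e0; exists (multL2 (trunc n) f) => //.
have bs := bounded_invsqrt_trunc n.
apply/reciprocal_dom; exists (multL2 (fun x => invsqrtH x * trunc n x) f).
apply/multopP.
apply: filterS2 (multL2E f bs) (multL2E f (bounded_trunc n)) => x -> ->.
by rewrite rmorphM mulrA.
Qed.

Lemma ker_reciprocal : op_ker recip = kerH.
Proof. by apply: ker_weighted => // x Hx; rewrite invr_eq0. Qed.

(** [recip f] is a limit of the values of [C_(phi,w)] at the truncations of
    [f / H], hence orthogonal to the kernel of the adjoint. *)
Lemma hclosure_ran_reciprocal f p : recip (f, p) ->
  hclosure (L2dot mu) (op_ran T) p.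
Proof.
move=> Sfp; have [k fk] := (reciprocal_dom f).1 (ex_intro _ p Sfp).
apply/hclosureP => e e0; have [n kn] := trunc_approx k e0.
have bi := bounded_inv_trunc n; have bt := bounded_trunc n.
set a := multL2 (fun x => invH x * trunc n x) f.
move/multopP in fk.
have [q Taq] : exists q, T (a, q).
  rewrite /T -weight1.
  apply: (@weighted_ex _ _ (multL2 (trunc n) k)); first exact: measurable_cst.
  apply/multopP; apply: filterS3 fk (multL2E f bi) (multL2E k bt).
  move=> x kE aE ->; rewrite kE /a aE [LHS]mulrA [RHS]mulrA.
  rewrite -!(rmorphM (real_complex R)) mulr1 [sqrtH x * _]mulrA sqrt_inv.
  by rewrite [trunc n x * _]mulrC.
exists q; first by exists a.
have Sq : wco mu phi (weight (fun x => invH x * (1 - trunc n x))) (f, p - q).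
  apply/weighted_wcoP; move/weighted_wcoP: Sfp => pE; move/wcoP: Taq => qE.
  have aE := nonsingular_eq nonsingular_weight (multL2E f bi).
  have E := L2_aeB p q.
  near=> x; rewrite (near E x) // (near pE x) // (near qE x) // /a.
  rewrite (near aE x) // !(rmorphM (real_complex R)) rmorphB rmorph1 /=; ring.
have m1t : measurable_fun setT (fun x => invH x * (1 - trunc n x)).
  apply: measurable_funM => //; apply: measurable_funB; last by case: bt.
  exact: measurable_cst.
have [k' /multopP k'E ->] := weighted_norm m1t Sq.
rewrite (_ : k' = k - multL2 (trunc n) k) //; apply: L2_ae_ext.
have E := L2_aeB k (multL2 (trunc n) k); have tE := multL2E k bt.
near=> x; rewrite (near k'E x) // (near E x) // (near tE x) // (near fk x) //.
rewrite -sqrt_inv !(rmorphM (real_complex R)) rmorphB rmorph1 /=; ring.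
Unshelve. all: by end_near. Qed.

(** Splitting a function according to whether H vanishes is the orthogonal
    decomposition into the closure of the range of the adjoint and the
    complement of that range. *)
Lemma reciprocal_adjoint_wco :
  reciprocal (L2dot mu) (adjoint (L2dot mu) T) = recip.
Proof.
have linS : linear_op recip := linear_weighted invH.
have kerp f : kerH (f - multL2 pos_ind f) := kerH_subpos f.
suff rS : is_reciprocal (L2dot mu) (adjoint (L2dot mu) T) recip.
  apply: xget_unique => // S rS'; apply: reciprocal_unique rS' rS => f g g'.
  exact: adjoint_functional hdense_wco.
split.
- by split=> //; exact: hdense_reciprocal.
- apply/seteqP; split=> f.
    move=> [g Sfg]; exists (multL2 pos_ind f), (f - multL2 pos_ind f).
    split; last by rewrite addrC subrK.
      by exists g; exact: adjoint_reciprocal.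
    by rewrite horth_ran_adjoint.
  move=> [a [b [[g Tga]]]]; rewrite horth_ran_adjoint -ker_reciprocal => Sb ->.
  have [p Sap] := adjoint_reciprocal_dom Tga.
  exists p; have [_ lin _] := linS; have := lin 1 _ _ _ _ Sap Sb.
  by rewrite !scale1r addr0.
- move=> f [g Sfg]; exists (multL2 pos_ind f).
    split; first exact: hclosure_ran_adjoint.
    move=> k kran; apply: dot_eq0C; apply: horth_hclosure kran _.
    by rewrite horth_ran_adjoint; exact: kerp.
  by exists g; split=> //; exact: adjoint_reciprocal.
- move=> g [f Tgf]; have [p Sfp] := adjoint_reciprocal_dom Tgf.
  exists p; last by exists f.
  have pker : horth (L2dot mu) (op_ker (adjoint (L2dot mu) T)) p.
    move=> q Tq; apply: horth_hclosure (hclosure_ran_reciprocal Sfp) _.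
    move=> b [a Tab]; apply: dot_eq0C; rewrite (Tq _ _ Tab) /=.
    exact: linear0r.
  split=> //= k kker; apply: dot_eq0C; apply: kker.
  have := adjointB Tgf (adjoint_reciprocal Sfp).
  by rewrite (adjoint_pos Tgf) subrr.
by rewrite ker_reciprocal horth_ran_adjoint.
Qed.

End FiniteDensity.

(** * Finiteness of the density, and the theorem *)

(** On the set E where the density is infinite every function of the domain of
    [C_(phi,w)] vanishes; by density of the domain so does every square
    integrable function, and E is null because the measure is sigma-finite. *)
Lemma density_fin_num (R : realType) (d : measure_display)
    (X : measurableType d) (mu : {sigma_finite_measure set X -> \bar R})
    (phi : X -> X) (w : X -> R[i]) (h : X -> \bar R) :
  measurable_fun [set: X] phi -> cmeasurable w ->
  hdense (L2dot mu) (op_dom (wco mu phi w)) -> is_wco_density mu phi w h ->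
  {ae mu, forall x, h x \is a fin_num}.
Proof.
move=> mphi mw dT [mh h0 hE].
pose E := h @^-1` [set +oo%E].
have mE : measurable E.
  by rewrite -[X in measurable X]setTI; apply: mh => //; exact: emeasurable_set1.
have mwE : measurable_fun setT (fun x => (csqr (w x))%:E).
  by apply/measurable_EFinP; exact: measurable_csqr.
have w0 x : (0 <= (csqr (w x))%:E)%E by rewrite lee_fin csqr_ge0.
have bE : bounded_mult (\1_E : X -> R).
  split; first exact: measurable_indic.
  by exists 1 => x; rewrite indicE; case: (_ \in _); rewrite ?normr1 ?normr0.
have domE (f : L2 mu) : op_dom (wco mu phi w) f -> multL2 \1_E f = 0.
  move=> [g /wcoP fg].
  have mf : measurable_fun setT (fun x => (csqr (f x))%:E).
    by apply/measurable_EFinP/measurable_csqr; exact: L2_cmeasurable.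
  have f0 x : (0 <= (csqr (f x))%:E)%E by rewrite lee_fin csqr_ge0.
  have If : mu.-integrable setT (fun x => (csqr (f x))%:E * h x)%E.
    apply/integrableP; split; first exact: emeasurable_funM.
    under eq_integral do rewrite gee0_abs ?mule_ge0 //.
    rewrite -(ge0_integral_density_comp mphi mwE w0 mh h0 hE mf f0).
    rewrite (_ : (\int[mu]_x _)%E = (sqnorm g)%:E) ?ltry //.
    rewrite (sqnorm_ae _ fg); last first.
      by apply: cmeasurableM => //; apply: cmeasurable_comp => //;
        exact: L2_cmeasurable.
    by apply: eq_integral => x _; rewrite csqrM EFinM muleC.
  apply: L2_ae_ext.
  apply: filterS3 (integrable_ae measurableT If) (multL2E f bE) (L2_ae0 mu).
  move=> x /(_ I) fin -> z0; rewrite z0 indicE.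
  have [|_] := boolP (x \in E); last by rewrite mul0r.
  rewrite inE /E /= => hx; rewrite hx in fin.
  rewrite (_ : f x = 0) ?mulr0 //; apply: csqr_eq0; apply/eqP.
  apply: contraTT fin => fx; rewrite gt0_muley //.
  by rewrite lte_fin lt_neqAle eq_sym fx csqr_ge0.
have allE (f : L2 mu) : multL2 \1_E f = 0.
  apply/sqnorm_eq0/eqP; rewrite eq_le sqnorm_ge0 andbT leNgt; apply/negP => e0.
  have /hclosureP/(_ _ e0)[g gdom] :
      hclosure (L2dot mu) (op_dom (wco mu phi w)) f.
    by rewrite [hclosure _ _]dT.
  rewrite ltNge => /negP; apply; rewrite -[leRHS]mul1r -[X in X * _](expr1n _ 2).
  rewrite (_ : multL2 \1_E f = multL2 \1_E (f - g)); last first.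
    by rewrite (multL2B f g bE) (domE g gdom) subr0.
  apply: sqnorm_multL2_le bE.1 _ => x.
  by rewrite indicE; case: (_ \in _); rewrite ?normr1 ?normr0.
have [F FX mF] := sigma_finiteT mu.
have aeF n : {ae mu, forall x, ~ (E x /\ F n x)}.
  have LF : square_integrable mu (fun x => (\1_(F n) x : R)%:C).
    split.
      by apply: cmeasurable_real; apply: measurable_indic; case: (mF n).
    rewrite (_ : (\int[mu]_x _)%E = (\int[mu]_x (\1_(F n) x : R)%:E)%E).
      by rewrite integral_indic ?setIT //; case: (mF n).
    apply: eq_integral => x _; rewrite /csqr indicE /=.
    by case: (_ \in _); rewrite /= ?expr1n !expr0n /= addr0.
  have := multL2E (toL2 mu (fun x => (\1_(F n) x : R)%:C)) bE; rewrite allE => E1.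
  apply: filterS3 E1 (toL2E LF) (L2_ae0 mu) => x E1 E2 E3 [Ex Fx].
  move/eqP: (etrans (esym E1) E3); rewrite E2 !indicE !mem_set //= mulr1.
  by rewrite oner_eq0.
have := ae_foralln aeF; apply: filterS => x EFx.
rewrite ge0_fin_numE // lt_neqAle leey andbT; apply/eqP => hx.
have : [set: X] x by []; rewrite FX => -[n _ Fx].
by apply: (EFx n).
Qed.

Lemma fine_inv (R : realType) (y : \bar R) : fine (y^-1)%E = (fine y)^-1.
Proof.
case: y => [r| |]; rewrite ?invey ?inveNy /= ?invr0 //.
by rewrite inver; case: (r =P 0) => [->|_]; rewrite /= ?invr0.
Qed.

Lemma fine_sqrt (R : realType) (y : \bar R) : fine (sqrte y) = Num.sqrt (fine y).
Proof. by case: y => [r| |] //=; rewrite sqrtr0. Qed.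

Theorem proposition3 (R : realType) (d : measure_display)
    (X : measurableType d) (mu : {sigma_finite_measure set X -> \bar R})
    (phi : X -> X) (w : X -> R[i]) (h : X -> \bar R) :
  measurable_fun [set: X] phi -> cmeasurable w ->
  wco_densely_defined mu phi w -> is_wco_density mu phi w h ->
  let dot : {dot (L2 mu) for conjC} := @L2_dot R d X mu in
  let T := wco mu phi w in
  let S := reciprocal dot (adjoint dot T) in
  let h' := fun x => (h (phi x))^-1%E in
  [/\ op_dom S =
        [set f : L2 mu | ecmul_in_L2 mu h' (fun x => w x * f (phi x))],
      forall f g : L2 mu, S (f, g) ->
        (g : X -> R[i]) = ecmul h' (fun x => w x * f (phi x)) %[ae mu]
    & S = op_comp (mul_op mu (fun x => (sqrte (h (phi x)))^-1%E))
                  (unitary_part dot T)].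
Proof.
move=> mphi mw [_ dT] hdens dot T S h'.
have hfin := density_fin_num mphi mw dT hdens.
case: hdens => mh h0 hE.
pose H x := fine (h x).
have mH : measurable_fun [set: X] H by exact: measurableT_comp.
have H0 x : 0 <= H x by exact: fine_ge0.
have dens A : measurable A ->
    mu_w mu w (phi @^-1` A) = (\int[mu]_(x in A) (H x)%:E)%E.
  move=> mA; rewrite hE //; apply: ae_eq_integral => //.
  - exact: measurable_funTS.
  - by apply/measurable_funTS/measurable_EFinP.
  - by apply: filterS hfin => x hx _; rewrite /H fineK.
have wH := ae_weight_density mphi mw mH dens.
have SE : S = wco mu phi (weight phi w (fun x => (H x)^-1)).
  exact: reciprocal_adjoint_wco.
have UE : unitary_part dot T =
    wco mu phi (weight phi w (fun x => (Num.sqrt (H x))^-1)).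
  exact: unitary_part_wco.
have SP (f g : L2 mu) : S (f, g) <->
    {ae mu, forall x, g x = ecmul h' (fun x => w x * f (phi x)) x}.
  rewrite SE weighted_wcoP /ecmul /h'; split; apply: filterS => x ->;
  by rewrite fine_inv mulrCA.
have mS (f : L2 mu) : cmeasurable (ecmul h' (fun x => w x * f (phi x))).
  rewrite (_ : ecmul _ _ = (fun x => ((H (phi x))^-1)%:C * (w x * f (phi x)))).
    apply: cmeasurable_realM.
      exact: (measurableT_comp (measurable_inv mH H0) mphi).
    by apply: cmeasurableM => //; apply: cmeasurable_comp => //;
      exact: L2_cmeasurable.
  by apply/funext => x; rewrite /ecmul /h' fine_inv.
split.
- apply/seteqP; split=> f.
    move=> [g /SP fg]; split.
      apply: filterS wH => x [->|Hx]; [by right; rewrite mul0r|left].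
      rewrite /h'.
      move: Hx (h0 (phi x)); rewrite /H; case: (h (phi x)) => [r| |] //= r0 _.
      by rewrite inver (negbTE r0).
    by apply: square_integrable_ae (L2_square_integrable g) _ => //;
      apply: filterS fg => x ->.
  move=> [_ Lf]; exists (toL2 mu (ecmul h' (fun x => w x * (f : L2 mu) (phi x)))).
  by apply/SP; exact: toL2E.
- by move=> f g /SP fg; exact/ae_trueP.
have invsqr x : (Num.sqrt (H x))^-1 * (Num.sqrt (H x))^-1 = (H x)^-1.
  by rewrite -invfM -expr2 sqr_sqrtr.
rewrite UE; apply/seteqP; split=> -[f g].
  rewrite SE => /weighted_wcoP fg.
  have [k fk] := polar_factor_total mphi mw mH H0 dens f.
  exists k; split=> //=; move/weighted_wcoP: fk => fk; split.
    apply: filterS2 wH fk => x [->|Hx] kE; [by right; rewrite kE mul0r|left].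
    move: Hx (h0 (phi x)); rewrite /H; case: (h (phi x)) => [r| |] //= r0.
    rewrite lee_fin => r1.
    by rewrite inver sqrtr_eq0 leNgt lt_neqAle eq_sym r0 r1.
  apply/ae_trueP; apply: filterS2 fg fk => x -> kE.
  rewrite /ecmul kE fine_inv fine_sqrt -/(H (phi x)) -invsqr.
  by rewrite (rmorphM (real_complex R)) /=; ring.
move=> [k [/= /weighted_wcoP fk [_ /ae_trueP kg]]].
rewrite SE; apply/weighted_wcoP; apply: filterS2 fk kg => x kE ->.
rewrite /ecmul kE fine_inv fine_sqrt -/(H (phi x)) -invsqr.
by rewrite (rmorphM (real_complex R)) /=; ring.
Qed.
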